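(* Let $M$ be a loop- and coloop-free matroid that is $4$-paving or $4$-copaving. Then $$T_M(2,0)\,T_M(0,2)\ge T_M(1,1)^2 .$$
   Context: All matroids are finite. $T_M(x,y)$ denotes the Tutte polynomial of $M$. A matroid $M$ of rank $r$ is $k$-paving if every circuit of $M$ has more than $r-k$ elements (so $1$-paving matroids are the usual paving matroids). $M$ is $k$-copaving if its dual $M^*$ is $k$-paving. The multiplicative Merino--Welsh inequality for a loop- and coloop-free matroid $M$ is $T_M(2,0)T_M(0,2)\ge T_M(1,1)^2$. *)

(* Defs.v *)
From mathcomp Require Import all_boot all_order all_algebra.
Set Implicit Arguments.
Unset Strict Implicit.
Unset Printing Implicit Defensive.

(* The ground set of a matroid is the whole finite type E (possibly empty). *)
Record matroid (E : finType) := Matroid {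
  indep : pred {set E};
  indep0 : indep set0;
  indepS : forall I J : {set E}, I \subset J -> indep J -> indep I;
  indepX : forall I J : {set E}, indep I -> indep J -> #|I| < #|J| ->
    exists2 x, x \in J :\: I & indep (x |: I)
}.

Section Matroid.

Variables (E : finType) (M : matroid E).
Implicit Types (A B C I J K : {set E}) (e : E) (k : nat).

Definition rank A : nat := \max_(I : {set E} | (I \subset A) && indep M I) #|I|.

Definition basis B : bool := maxset (indep M) B.

Definition circuit C : bool := minset (fun A => ~~ indep M A) C.

Definition loop e : bool := circuit [set e].

(* The condition #|C| > rank - k is stated without truncated subtraction. *)
Definition paving k : Prop :=
  forall C, circuit C -> rank [set: E] < #|C| + k.

Local Open Scope ring_scope.

(* The corank-nullity expansion in Z[x, y]: in {poly {poly int}}, x is 'X, y is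
   'Y := 'X%:P, and T.[a, b] is the value at x = a, y = b. The natural-number
   subtractions are exact since rank A <= #|A| and rank A <= rank E. *)
Definition tutte : {poly {poly int}} :=
  \sum_(A : {set E})
     ('X - 1) ^+ (rank [set: E] - rank A)%N * ('Y - 1) ^+ (#|A| - rank A)%N.

Local Close Scope ring_scope.

Lemma basis_indep B : basis B -> indep M B.
Proof. by case/maxsetP. Qed.

Lemma indep_augment I J : indep M I -> indep M J -> #|I| <= #|J| ->
  exists K, [/\ indep M K, I \subset K, K \subset I :|: J & #|K| = #|J|].
Proof.
move=> + indJ; move: {2}(#|J| - #|I|) (leqnn (#|J| - #|I|)) => n.
elim: n I => [|n IHn] I le_n indI leIJ.
  exists I; rewrite subxx subsetUl; split=> //.
  by apply/eqP; rewrite eqn_leq leIJ -subn_eq0 -leqn0.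
move: leIJ; rewrite leq_eqVlt => /predU1P[eqIJ|ltIJ].
  by exists I; rewrite subxx subsetUl.
have [x /setDP[xJ xI] indxI] := indepX indI indJ ltIJ.
have cxI : #|x |: I| = #|I|.+1 by rewrite cardsU1 xI.
have [|||K [indK sK sKJ cK]] := IHn (x |: I); rewrite ?cxI //.
  by rewrite subnS -subn1 leq_subLR add1n.
exists K; split=> //; first exact: subset_trans (subsetUr _ _) sK.
apply: subset_trans sKJ _; rewrite subUset subsetUr subUset subsetUl !andbT.
by rewrite sub1set inE xJ orbT.
Qed.

Lemma indep_card_basis I B : basis B -> indep M I -> #|I| <= #|B|.
Proof.
case/maxsetP=> indB maxB indI; rewrite leqNgt; apply/negP=> ltBI.
have [x /setDP[_ /negP xB] indxB] := indepX indB indI ltBI.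
by apply: xB; have <- := maxB _ indxB (subsetUr _ _); exact: setU11.
Qed.

Lemma basis_card I B : basis B -> indep M I -> #|I| = #|B| -> basis I.
Proof.
move=> bB indI cI; apply/maxsetP; split=> // J indJ sIJ; apply/eqP.
by rewrite eq_sym eqEcard sIJ cI (indep_card_basis bB).
Qed.

Definition dual_indep A : bool :=
  [exists B : {set E}, basis B && (A \subset ~: B)].

Lemma dual_indep0 : dual_indep set0.
Proof.
have [B bB _] := maxset_exists (indep0 M).
by apply/existsP; exists B; rewrite sub0set andbT.
Qed.

Lemma dual_indepS I J : I \subset J -> dual_indep J -> dual_indep I.
Proof.
move=> sIJ /existsP[B /andP[bB sJ]].
by apply/existsP; exists B; rewrite bB (subset_trans sIJ).
Qed.

Lemma dual_indepX I J : dual_indep I -> dual_indep J -> #|I| < #|J| ->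
  exists2 x, x \in J :\: I & dual_indep (x |: I).
Proof.
move=> /existsP[B1 /andP[b1 s1]] /existsP[B2 /andP[b2 s2]] ltIJ.
have indD : indep M (B2 :\: I) := indepS (subsetDl _ _) (basis_indep b2).
have [B [indB sDB sB cB]] :=
  indep_augment indD (basis_indep b1) (indep_card_basis b1 indD).
have bB : basis B := basis_card b1 indB cB.
have sIB : I \subset ~: B.
  apply/subsetP=> x xI; rewrite inE; apply/negP=> /(subsetP sB).
  by rewrite !inE xI /=; apply/negP; have := subsetP s1 x xI; rewrite inE.
have [sJB|/subsetPn[x xJI xB]] := boolP (J :\: I \subset B); last first.
  exists x => //; apply/existsP; exists B.
  by rewrite bB subUset sIB sub1set inE xB.
have disj : [disjoint J :\: I & B2 :\: I].
  rewrite disjoints_subset; apply/subsetP=> x /setDP[xJ xI].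
  by rewrite !inE xI /=; have := subsetP s2 x xJ; rewrite inE.
have le1 : #|J :\: I| + #|B2 :\: I| <= #|B2|.
  have -> : #|J :\: I| + #|B2 :\: I| = #|(J :\: I) :|: (B2 :\: I)|.
    by apply/esym/eqP; rewrite (leq_card_setU _ _).2.
  apply: leq_trans (indep_card_basis b2 indB); apply: subset_leq_card.
  by rewrite subUset sJB.
have le2 : #|B2 :&: I| <= #|I :\: J|.
  apply: subset_leq_card; apply/subsetP=> x /setIP[xB2 xI].
  rewrite inE xI andbT; apply/negP=> /(subsetP s2).
  by rewrite inE xB2.
move: ltIJ; rewrite -(cardsID J I) -(cardsID I J) [J :&: I]setIC ltn_add2l.
rewrite -(cardsID I B2) leq_add2r in le1.
by rewrite ltnNge (leq_trans le1 le2).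
Qed.

Definition dual : matroid E := Matroid dual_indep0 dual_indepS dual_indepX.

End Matroid.

Definition coloop (E : finType) (M : matroid E) (e : E) : bool := loop (dual M) e.

Definition copaving (E : finType) (M : matroid E) (k : nat) : Prop :=
  paving (dual M) k.

Lemma dual_basis (E : finType) (M : matroid E) (B : {set E}) :
  basis (dual M) B = basis M (~: B).
Proof.
apply/idP/idP.
  case/maxsetP=> /existsP[A /andP[bA sBA]] maxB.
  suff -> : B = ~: A by rewrite setCK.
  by rewrite -(maxB (~: A)) //; apply/existsP; exists A; rewrite bA /=.
move=> bB; apply/maxsetP; split.
  by apply/existsP; exists (~: B); rewrite bB setCK /=.
move=> C /existsP[A /andP[bA sCA]] sBC; apply/eqP.
rewrite eq_sym eqEcard sBC /=; apply: leq_trans (subset_leq_card sCA) _.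
have := indep_card_basis bA (basis_indep bB).
by rewrite -(leq_add2r #|~: A|) cardsC -(cardsC B) [#|B| + _]addnC leq_add2l.
Qed.

Import GRing.Theory.

Lemma horner2_tutte (E : finType) (M : matroid E) (a b : int) :
  ((tutte M).[a, b] = \sum_(A : {set E})
     (a - 1) ^+ (rank M [set: E] - rank M A)%N * (b - 1) ^+ (#|A| - rank M A)%N)%R.
Proof.
rewrite /tutte !horner_sum; apply: eq_bigr => A _.
by rewrite !(hornerM, horner_exp, hornerD, hornerN, hornerX, hornerC).
Qed.

(* Main.v *)
(* Attach to a basis B the bipartite graph of its basis exchanges, and let alpha
   be obtained by deleting the elements one at a time in a uniformly random
   order, each with weight 1, or, if it is isolated at that time, with weight 2
   in B and 0 outside. Averaging deletion-contraction over all elements gives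
   T(2,0) = sum_B alpha(B), T(0,2) = sum_B alpha(complement of B), and T(1,1) is
   the number of bases. So if alpha(B) alpha(complement of B) >= 1 for each B,
   the inequality follows from Cauchy-Schwarz.

   If some e is in no parallel and no series pair, the matroids M \ e and M / e
   satisfy the hypotheses again and the inequality follows by Cauchy-Schwarz
   from the two smaller instances. Otherwise 4-paving forces rank at most 5 (a
   parallel pair is a small dependent set) or nullity at most 5 (replace the
   series partners of the elements outside B by one of these elements), and the
   graph inequality holds when one side has at most 5 vertices. Its proof is an
   induction that removes a vertex, or a star of leaves with its centre; the
   finitely many starting bounds are computed, and bounds above 1 on the smaller
   sides give the room needed at the stars. *)
From Stdlib Require Import NArith.
Require Import Defs.
From mathcomp Require Import all_boot all_order all_algebra.
From mathcomp Require Import zify ring lra.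
Set Implicit Arguments.
Unset Strict Implicit.
Unset Printing Implicit Defensive.
Import Order.TTheory GRing.Theory Num.Theory.
Local Open Scope ring_scope.

(** * Permutation Tutte values of bipartite graphs *)

(** Averaging over one deleted vertex [v] breaks down only when [v] has leaves: they become
    isolated, and an isolated vertex has weight 0 for the side that does not contain it, so the
    product for the remaining graph is 0. The loss is recovered from the mixed terms in the product
    of the two sums, where the [k] isolated leaves give the factor [2 ^ k] on their own side. With a
    bound [c] for the graph and [g] for the graph without the star, the step goes through as soon as
    [(2 * k + 1) * c <= 2 ^ k * g]. For [k >= 3] even [c = g = 1] will do, since 7 <= 8; but [k = 1]
    asks for [g >= 3/2 * c] and [k = 2] for [g >= 5/4 * c]. Hence the bound 1 at five vertices rests
    on 3/2, 9/4, 27/8 and 81/16 at four, three, two and one, which are available once the other side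
    is large. They fail for sides of equal size, where a perfect matching gives exactly 1; there the
    degree of the centre and the computed values have to help. *)

Section PermTutte.

Variables (E : finType) (adj : rel E).
Implicit Types (B S R J : {set E}) (v w : E) (x y : rat).

Definition nbr S v : {set E} := [set w in S | adj v w].

Definition weight x y B S v : rat :=
  if nbr S v == set0 then (if v \in B then x else y) else 1.

Fixpoint pt_rec x y B n S : rat :=
  if n is n'.+1 then
    (\sum_(v in S) weight x y B S v * pt_rec x y B n' (S :\ v)) / n'.+1%:R
  else 1.

Definition pt x y B S := pt_rec x y B #|S| S.

Lemma pt0 x y B : pt x y B set0 = 1.
Proof. by rewrite /pt cards0. Qed.

Lemma ptE x y B S :
  #|S|%:R * pt x y B S = \sum_(v in S) weight x y B S v * pt x y B (S :\ v).
Proof.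
rewrite /pt; case cS: #|S| => [|n].
  by rewrite mul0r big1 // => v vS; move: vS; rewrite (cards0_eq cS) inE.
rewrite /= mulrC divfK ?pnatr_eq0 //; apply: eq_bigr => v vS.
by move: cS; rewrite (cardsD1 v) vS add1n => -[->].
Qed.

Lemma ptS x y B S : S != set0 ->
  pt x y B S = (\sum_(v in S) weight x y B S v * pt x y B (S :\ v)) / #|S|%:R.
Proof.
move=> S0; rewrite -ptE mulrAC divff ?mul1r //.
by rewrite pnatr_eq0 cards_eq0.
Qed.

Lemma pt11 B S : pt 1 1 B S = 1.
Proof.
have [n] := ubnP #|S|; elim: n S => // n IHn S.
rewrite ltnS => leSn; have [->|S0] := eqVneq S set0; first by rewrite pt0.
rewrite ptS // (eq_bigr (fun=> 1)) => [|v vS].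
  by rewrite sumr_const divff // pnatr_eq0 cards_eq0.
rewrite IHn; first by rewrite /weight; do 2?case: ifP; rewrite mulr1.
by move: leSn; rewrite (cardsD1 v) vS.
Qed.

Lemma ptC x y B S : pt x y (~: B) S = pt y x B S.
Proof.
rewrite /pt; move: #|S| => n; elim: n S => //= n IHn S; congr (_ / _).
apply: eq_bigr => v _; rewrite IHn /weight inE; congr (_ * _).
by case: (_ == _); case: (v \in B).
Qed.

End PermTutte.

Lemma eq_pt (E : finType) (adj adj' : rel E) x y (B B' S : {set E}) :
    {in S &, adj =2 adj'} -> {in S, B =i B'} ->
  pt adj x y B S = pt adj' x y B' S.
Proof.
rewrite /pt; move: #|S| => n; elim: n S => //= n IHn S eq_adj eqB; congr (_ / _).
apply: eq_bigr => v vS; congr (_ * _).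
  rewrite /weight eqB //; suff -> : nbr adj S v = nbr adj' S v by [].
  by apply/setP=> w; rewrite !inE; have [wS|] //= := boolP (w \in S); rewrite eq_adj.
apply: IHn => [u w|u]; rewrite !inE => /andP[_ uS]; last exact: eqB.
by move=> /andP[_ wS]; exact: eq_adj.
Qed.

(** * Behaviour of [alpha] when vertices are removed *)

Section Alpha.

Variables (E : finType) (adj : rel E).
Hypothesis adjC : symmetric adj.
Implicit Types (B S R J : {set E}) (v w b e l : E).

Definition bipartite B := forall v w, adj v w -> (v \in B) != (w \in B).

Definition alpha B S := pt adj 2 0 B S.

Local Notation nbr := (nbr adj).
Local Notation wt := (weight adj 2 0).

Lemma bipartiteC B : bipartite B -> bipartite (~: B).
Proof. by move=> bip v w /bip; rewrite !inE; do 2!case: (_ \in _). Qed.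

Lemma in_nbr S v w : (w \in nbr S v) = (w \in S) && adj v w.
Proof. by rewrite inE. Qed.

Lemma nbrD1 S v w : nbr (S :\ w) v = nbr S v :\ w.
Proof. by apply/setP=> u; rewrite !inE andbA. Qed.

Lemma alphaE B S :
  #|S|%:R * alpha B S = \sum_(v in S) wt B S v * alpha B (S :\ v).
Proof. exact: ptE. Qed.

Lemma alpha0 B : alpha B set0 = 1. Proof. exact: pt0. Qed.

Lemma weight_ge0 B S v : 0 <= wt B S v.
Proof. by rewrite /weight; do 2?case: ifP. Qed.

Lemma alpha_ge0 B S : 0 <= alpha B S.
Proof.
have [n] := ubnP #|S|; elim: n S => // n IHn S.
rewrite ltnS => leSn; have [->|S0] := eqVneq S set0; first by rewrite alpha0.
rewrite /alpha ptS // mulr_ge0 ?invr_ge0 // sumr_ge0 // => v vS.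
rewrite mulr_ge0 ?weight_ge0 // IHn //.
by move: leSn; rewrite (cardsD1 v) vS.
Qed.

Lemma nbr_neq0 S v w : w \in S -> adj v w -> (nbr S v == set0) = false.
Proof. by move=> wS vw; apply/negbTE/set0Pn; exists w; rewrite in_nbr wS. Qed.

Lemma card_gt0_neq S v : v \in S -> S != set0.
Proof. by move=> vS; apply/set0Pn; exists v. Qed.

(** An isolated [v] stays isolated under deletions and enters no other weight, so the same factor
    appears whenever [v] is deleted. *)
Lemma alpha_isolated B S v : v \in S -> nbr S v = set0 ->
  alpha B S = (if v \in B then 2 else 0) * alpha B (S :\ v).
Proof.
have [n] := ubnP #|S|; elim: n S => // n IHn S; rewrite ltnS => leSn vS iso.
set c := if _ then _ else _.
have cS := cardsD1 v S; rewrite vS add1n in cS.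
apply: (@mulfI _ #|S|%:R); first by rewrite pnatr_eq0 cards_eq0 (card_gt0_neq vS).
rewrite alphaE (big_setD1 v) //= {1}/weight iso eqxx -/c.
rewrite (eq_bigr (fun w => c * (wt B (S :\ v) w * alpha B (S :\ v :\ w)))).
  by rewrite -big_distrr /= -alphaE cS -natr1; ring.
move=> w; rewrite !inE => /andP[wv wS].
have vw : ~~ adj v w.
  by apply/negP=> vw; move/setP/(_ w): iso; rewrite !inE wS vw.
have -> : wt B (S :\ v) w = wt B S w.
  rewrite /weight nbrD1; suff -> : nbr S w :\ v = nbr S w by [].
  by apply/setDidPl; rewrite disjoint_sym disjoints1 !inE vS adjC.
have -> : S :\ v :\ w = S :\ w :\ v by rewrite !setDDl setUC.
rewrite (IHn (S :\ w)) ?inE 1?eq_sym ?wv //; first by rewrite -/c; ring.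
  by move: leSn; rewrite (cardsD1 w) wS.
by rewrite nbrD1 iso set0D.
Qed.

Lemma alpha_isolated_set B S J : J \subset S -> J \subset B ->
  {in J, forall l, nbr S l = set0} -> alpha B S = 2 ^+ #|J| * alpha B (S :\: J).
Proof.
have [n] := ubnP #|J|; elim: n S J => // n IHn S J; rewrite ltnS => leJn JS JB iso.
have [->|[l lJ]] := set_0Vmem J; first by rewrite setD0 cards0 expr0 mul1r.
have lS := subsetP JS l lJ.
rewrite (alpha_isolated B lS (iso l lJ)) (subsetP JB) //.
rewrite (IHn (S :\ l) (J :\ l)).
- rewrite (cardsD1 l J) lJ exprD expr1 mulrA; congr (_ * alpha B _).
  by rewrite setDDl -[in RHS](setD1K lJ).
- by move: leJn; rewrite (cardsD1 l) lJ.
- exact: setSD.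
- exact: subset_trans (subsetDl _ _) JB.
by move=> k; rewrite inE => /andP[_ kJ]; rewrite nbrD1 iso ?set0D.
Qed.

(** Termwise comparison: losing the outside vertex [e] can only raise the weight of a vertex of [B],
    from 1 to 2 when it becomes isolated, and the term of [e] itself has weight at most 1. *)
Lemma alpha_setD1_ge B S e : bipartite B -> e \in S -> e \notin B ->
  alpha B S <= alpha B (S :\ e).
Proof.
move=> bip; have [n] := ubnP #|S|; elim: n S => // n IHn S.
rewrite ltnS => leSn eS eB.
have cS := cardsD1 e S; rewrite eS add1n in cS.
have S0 : 0 < #|S|%:R :> rat by rewrite ltr0n cS.
rewrite -(ler_pM2l S0) alphaE (big_setD1 e) //= cS.
rewrite -[X in _ <= X%:R * _]addn1 natrD mulrDl mul1r addrC.
rewrite alphaE lerD //.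
  apply: ler_sum => w; rewrite !inE => /andP[we wS].
  have -> : S :\ e :\ w = S :\ w :\ e by rewrite !setDDl setUC.
  apply: ler_pM; rewrite ?weight_ge0 ?alpha_ge0 //.
    rewrite /weight nbrD1; case: (boolP (w \in B)) => wB.
      by case: eqP => [->|_]; [rewrite set0D eqxx|case: ifP].
    suff -> : nbr S w :\ e = nbr S w by [].
    apply/setDidPl; rewrite disjoint_sym disjoints1 !inE eS /=.
    by apply/negP=> /bip; rewrite (negbTE eB) (negbTE wB).
  rewrite IHn ?inE 1?eq_sym ?we //.
  by move: leSn; rewrite (cardsD1 w) wS.
rewrite -[leRHS]mul1r ler_wpM2r ?alpha_ge0 // /weight (negbTE eB).
by case: ifP.
Qed.

(** A single edge contributes the factor 1: deleting [b] leaves [e] isolated with weight 0, deleting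
    [e] leaves [b] isolated with weight 2, and these average to 1. *)
Lemma alpha_edge B S b e : bipartite B -> b \in S -> e \in S -> b \in B ->
  nbr S b = [set e] -> nbr S e = [set b] -> alpha B S = alpha B (S :\ b :\ e).
Proof.
move=> bip; have [n] := ubnP #|S|; elim: n S => // n IHn S.
rewrite ltnS => leSn bS eS bB nb ne.
have be : adj b e by move/setP/(_ e): nb; rewrite !inE eS eqxx.
have eB : e \notin B by move/bip: be; rewrite bB; case: (e \in B).
have neb : e != b by apply: contraNneq eB => ->.
have cS : #|S| = #|S :\ b :\ e|.+2.
  by rewrite (cardsD1 b S) bS (cardsD1 e (S :\ b)) !inE neb eS.
have S0 : #|S|%:R != 0 :> rat by rewrite pnatr_eq0 cS.
apply: (mulfI S0); rewrite alphaE (big_setD1 b) //= (big_setD1 e) ?inE ?neb //=.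
have -> : alpha B (S :\ b) = 0.
  rewrite (@alpha_isolated _ _ e) ?inE ?neb ?(negbTE eB) ?mul0r //.
  by rewrite nbrD1 ne setDv.
have -> : wt B S e = 1 by rewrite /weight (@nbr_neq0 S e b) // adjC.
have -> : alpha B (S :\ e) = 2 * alpha B (S :\ b :\ e).
  rewrite (@alpha_isolated _ _ b) ?inE ?bB 1?eq_sym ?neb //.
    by rewrite !setDDl setUC.
  by rewrite nbrD1 nb setDv.
rewrite (eq_bigr (fun w => wt B (S :\ b :\ e) w * alpha B (S :\ b :\ e :\ w))).
  by rewrite -alphaE cS -[_.+2%:R]natr1 -[_.+1%:R]natr1; ring.
move=> w; rewrite !inE => /and3P[we wb wS].
have nwb : ~~ adj w b.
  apply/negP; rewrite adjC => bw; move/setP/(_ w): nb.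
  by rewrite !inE wS bw (negbTE we).
have nwe : ~~ adj w e.
  apply/negP; rewrite adjC => ew; move/setP/(_ w): ne.
  by rewrite !inE wS ew (negbTE wb).
congr (_ * _).
  rewrite /weight !nbrD1; suff -> : nbr S w :\ b :\ e = nbr S w by [].
  apply/setP=> u; rewrite !inE; case: eqVneq => [->|_] /=.
    by rewrite (negbTE nwe) andbF.
  by case: eqVneq => [->|//] /=; rewrite (negbTE nwb) andbF.
have nD u : u != w -> [set u] :\ w = [set u].
  by move=> uw; apply/setDidPl; rewrite disjoints1 inE.
have leS : (#|S :\ w| < n)%N by move: leSn; rewrite (cardsD1 w) wS.
have bw : b \in S :\ w by rewrite !inE eq_sym wb.
have ew : e \in S :\ w by rewrite !inE eq_sym we.
rewrite (IHn _ leS bw ew bB) ?nbrD1 ?nb ?ne ?nD //; try by rewrite eq_sym.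
by congr (alpha B _); apply/setP=> u; rewrite !inE; do !case: (_ == _).
Qed.

End Alpha.

Lemma big_disjointU (E : finType) (V : nmodType) (A B : {set E}) (F : E -> V) :
  [disjoint A & B] ->
  \sum_(i in A :|: B) F i = \sum_(i in A) F i + \sum_(i in B) F i.
Proof.
move=> dAB; rewrite (big_setID A) /= setUK setDUl setDv set0U.
by have /setDidPl -> : [disjoint B & A] by rewrite disjoint_sym.
Qed.

(** * Attaching a star *)

Section Star.

Variables (E : finType) (adj : rel E).
Hypothesis adjC : symmetric adj.
Implicit Types (B S R J : {set E}) (v w b e l : E).
Local Notation nbr := (nbr adj).
Local Notation wt := (weight adj 2 0).
Local Notation alpha := (alpha adj).
Local Notation bipartite := (bipartite adj).

(** In a random order the centre must come after its [j] leaves, with probability [1 / (j + 1)],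
    since otherwise a leaf ends up isolated with weight 0; its weight is 2 instead of 1 if it also
    comes after [d] further neighbours, with probability [1 / (d + j + 1)]. *)
Definition gain (j d : nat) : rat := j.+1%:R^-1 + (d + j).+1%:R^-1.

Lemma gain_ge0 j d : 0 <= gain j d.
Proof. by rewrite addr_ge0 ?invr_ge0. Qed.

Lemma gain_step0 d : (if d == 0%N then 2 else 1) +
  d%:R * (gain 0 d.-1 - gain 0 d) = gain 0 d.
Proof.
case: d => [|d]; first by rewrite /gain; field.
rewrite /gain /= !addn0 -[d.+2%:R]natr1 -[d.+1%:R]natr1.
have d0 : 0 <= d%:R :> rat by [].
by field; rewrite !gt_eqF //; lra.
Qed.

(** The deletion recursion for a star with [j + 1] leaves: a leaf or one of the [d] further
    neighbours is deleted, and the term of the centre is 0. In [gain_step0] there are no leaves and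
    the centre contributes its weight. *)
Lemma gain_step j d : j.+1%:R * gain j d +
  d%:R * (gain j.+1 d.-1 - gain j.+1 d) = j.+2%:R * gain j.+1 d.
Proof.
have j0 : 0 <= j%:R :> rat by [].
have d0 : 0 <= d%:R :> rat by [].
case: d d0 => [|d] d0.
  rewrite /gain /= mul0r addr0 -![j.+2%:R]natr1 -![j.+1%:R]natr1.
  by field; rewrite !gt_eqF //; lra.
rewrite /gain /= !addSn !addnS -![(d + j).+3%:R]natr1 -![(d + j).+2%:R]natr1.
rewrite -![(d + j).+1%:R]natr1 !natrD -![j.+2%:R]natr1 -![j.+1%:R]natr1.
rewrite -!natr1 in d0 *.
have d1 : 0 <= d%:R :> rat by [].
by field; rewrite !gt_eqF //; lra.
Qed.

Lemma gain_pred_ge j d : gain j d <= gain j d.-1.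
Proof.
rewrite lerD2l lef_pV2 ?posrE ?ltr0n // ler_nat ltnS leq_add2r.
exact: leq_pred.
Qed.

(* Adding a star with centre [v] and leaves [J] multiplies [alpha] by at least
   the value the recursion would give if [v] and [J] were independent of [R];
   the numerical induction step is an equality (gain_step). *)
Lemma alpha_star_ge B R J v : bipartite B -> v \in B -> v \notin R ->
    v \notin J -> [disjoint J & B] -> [disjoint R & J] ->
    {in J, forall l, nbr (v |: (R :|: J)) l = [set v]} ->
  gain #|J| #|nbr R v| * alpha B R <= alpha B (v |: (R :|: J)).
Proof.
move=> bip vB.
have [n] := ubnP (#|R| + #|J|)%N; elim: n R J => // n IHn R J.
rewrite ltnS => le_n vR vJ dJB dRJ leafJ; set S := v |: _ in leafJ *.
set j := #|J|; set d := #|nbr R v|.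
have vRJ : v \notin R :|: J by rewrite inE negb_or vR vJ.
have cS : #|S| = (#|R| + j).+1.
  rewrite cardsU1 vRJ add1n; congr _.+1.
  by apply/eqP; rewrite (leq_card_setU R J).2.
have S0 : 0 < #|S|%:R :> rat by rewrite ltr0n cS.
have SvE : S :\ v = R :|: J by rewrite /S setU1K.
rewrite -(ler_pM2l S0) alphaE (big_setD1 v) ?setU11 //= SvE big_disjointU //=.
have [aR0 aR] := (alpha_ge0 adj B R, alphaE adj B R).
(* When there is a leaf the term of [v] is 0 anyway, since that leaf becomes isolated outside
   [B]. *)
have vT : (if j == 0 then if d == 0 then 2 else 1 else 0) * alpha B R
    <= wt B S v * alpha B (R :|: J).
  have [j0|_] := eqVneq j 0%N; last by rewrite mul0r mulr_ge0 ?weight_ge0 ?alpha_ge0.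
  have J0 : J = set0 by apply/eqP; rewrite -cards_eq0 -/j j0.
  rewrite J0 setU0 ler_wpM2r // /weight vB.
  suff -> : nbr S v = nbr R v by rewrite /d cards_eq0; case: ifP.
  apply/setP=> u; rewrite !in_nbr !inE J0 inE orbF.
  case: (eqVneq u v) => [->|//] /=; rewrite (negbTE vR) /=.
  by apply/negP=> /bip; rewrite eqxx.
have JT : j%:R * (gain j.-1 d * alpha B R) <=
    \sum_(l in J) wt B S l * alpha B (S :\ l).
  rewrite mulr_natl -sumr_const; apply: ler_sum => l lJ.
  have lR : l \notin R by rewrite (disjointFl dRJ).
  have lv : l != v by apply: contraNneq vJ => <-.
  have -> : wt B S l = 1.
    rewrite /weight (leafJ l lJ); case: eqP => // /setP/(_ v).
    by rewrite !inE eqxx.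
  have -> : S :\ l = v |: (R :|: (J :\ l)).
    apply/setP=> u; rewrite !inE; case: (eqVneq u l) => [->|_] //=.
    by rewrite (negbTE lv) (negbTE lR).
  have cJ : j = #|J :\ l|.+1 by rewrite /j (cardsD1 l) lJ.
  have sJ : J :\ l \subset J := subsetDl _ _.
  rewrite mul1r cJ /=; apply: IHn => //.
  - by move: le_n; rewrite -/j cJ addnS.
  - by rewrite inE negb_and vJ orbT.
  - exact: disjointWl dJB.
  - exact: disjointWr dRJ.
  move=> k; rewrite inE => /andP[kl kJ].
  have -> : v |: (R :|: J :\ l) = S :\ l.
    apply/setP=> u; rewrite !inE; case: (eqVneq u l) => [->|_] //=.
    by rewrite (negbTE lv) (negbTE lR).
  by rewrite nbrD1 (leafJ k kJ); apply/setDidPl; rewrite disjoints1 inE eq_sym.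
have RT : gain j d * (#|R|%:R * alpha B R) +
    d%:R * ((gain j d.-1 - gain j d) * alpha B R) <=
    \sum_(w in R) wt B S w * alpha B (S :\ w).
  have -> : d%:R * ((gain j d.-1 - gain j d) * alpha B R) =
      \sum_(w in R) if w \in nbr R v then (gain j d.-1 - gain j d) * alpha B R else 0.
    rewrite mulr_natl -sumr_const big_mkcond [RHS]big_mkcond /=.
    by apply: eq_bigr => w _; rewrite in_nbr; case: (w \in R); case: (adj v w).
  rewrite aR big_distrr -big_split /=; apply: ler_sum => w wR.
  have wv : w != v by apply: contraNneq vR => <-.
  have wJ : w \notin J by rewrite (disjointFr dRJ).
  have SwE : S :\ w = v |: (R :\ w :|: J).
    apply/setP=> u; rewrite !inE; case: (eqVneq u w) => [->|_] //=.
    by rewrite (negbTE wv) (negbTE wJ).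
  have cR : #|R| = #|R :\ w|.+1 by rewrite (cardsD1 w) wR.
  have sR : R :\ w \subset R := subsetDl _ _.
  have IH : gain j #|nbr (R :\ w) v| * alpha B (R :\ w) <= alpha B (S :\ w).
    rewrite SwE; apply: IHn => //.
    - by move: le_n; rewrite cR addSn.
    - by rewrite inE negb_and vR orbT.
    - exact: disjointWl dRJ.
    move=> k kJ; rewrite -SwE nbrD1 (leafJ k kJ).
    by apply/setDidPl; rewrite disjoints1 inE eq_sym.
  have wkJ k : k \in J -> ~~ adj w k.
    move=> kJ; apply/negP; rewrite adjC => kw; move/setP/(_ w): (leafJ k kJ).
    by rewrite !inE wR (negbTE wv) kw orbT.
  (* A neighbour [w] of [v] is outside [B] and has weight 1 thanks to [v]; [alpha_setD1_ge] then
     pays for the increase of [gain] when one neighbour is lost. Any other [w] has the same weight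
     in [S] as in [R]. *)
  case: ifPn => [wN|wN].
    have vw : adj v w by move: wN; rewrite in_nbr => /andP[].
    have wB : w \notin B by move/bip: vw; rewrite vB; case: (w \in B).
    have -> : wt B S w = 1 by rewrite /weight (@nbr_neq0 _ _ S w v) ?setU11 // adjC.
    have cN : #|nbr (R :\ w) v| = d.-1 by rewrite nbrD1 /d [in RHS](cardsD1 w) wN.
    rewrite mul1r; apply: le_trans IH; rewrite cN.
    have le1 : wt B R w <= 1 by rewrite /weight (negbTE wB); case: ifP.
    have := alpha_setD1_ge bip wR wB.
    have := alpha_ge0 adj B (R :\ w); have := gain_ge0 j d.
    have := gain_pred_ge j d; move: (gain j d) (gain j d.-1) => g g' gg' g0 a0 aa.
    have : wt B R w * alpha B (R :\ w) <= alpha B (R :\ w).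
      by rewrite -[leRHS]mul1r ler_wpM2r.
    move: (wt B R w * _) => z zle.
    have h1 : g * z <= g * alpha B (R :\ w) by rewrite ler_wpM2l.
    have h2 : (g' - g) * alpha B R <= (g' - g) * alpha B (R :\ w).
      by rewrite ler_wpM2l // subr_ge0.
    by apply: le_trans (lerD h1 h2) _; rewrite -mulrDl addrC subrK.
  have nvw : ~~ adj v w by move: wN; rewrite in_nbr wR.
  have nE : nbr S w = nbr R w.
    apply/setP=> u; rewrite !in_nbr !inE.
    case: (boolP (u \in R)) => [_|uR]; first by rewrite orbT.
    case: (eqVneq u v) => [->|_] /=; first by rewrite adjC (negbTE nvw).
    by case: (boolP (u \in J)) => //= uJ; rewrite (negbTE (wkJ u uJ)).
  have cN : nbr (R :\ w) v = nbr R v.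
    by rewrite nbrD1; apply/setDidPl; rewrite disjoint_sym disjoints1.
  have -> : wt B S w = wt B R w by rewrite /weight nE.
  rewrite addr0 mulrCA.
  by rewrite cN -/d in IH; rewrite ler_wpM2l ?weight_ge0.
apply: le_trans (lerD vT (lerD RT JT)); rewrite cS.
move: RT JT vT; rewrite /j; case: #|J| => [|i] _ _ _ /=.
  rewrite mul0r addr0 addn0.
  have := gain_step0 d; rewrite -natr1; move: (if _ then _ else _) (gain 0 d) => z g.
  by move=> gE; rewrite -[X in _ <= _ + X]addrC; nra.
have := gain_step i d; rewrite addnS -[(_ + _).+2%:R]natr1 -[(_ + _).+1%:R]natr1 natrD.
rewrite -[i.+2%:R]natr1 -[i.+1%:R]natr1.
move: (gain i d) (gain i.+1 d) (gain i.+1 d.-1) => g g1 g2 gE.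
nra.
Qed.

End Star.

(** * The induction step *)

(** Only the mixed terms matter: the square of [x * y' + x' * y] is at least 4 times the product of
    its two terms, and that product is at least [(c * n * n') ^ 2]. *)
Lemma cauchy_add (c x y n x' y' n' : rat) :
    0 <= c -> 0 <= x -> 0 <= y -> 0 <= n -> 0 <= x' -> 0 <= y' -> 0 <= n' ->
    c * n ^+ 2 <= x * y -> c * n' ^+ 2 <= x' * y' ->
  c * (n + n') ^+ 2 <= (x + x') * (y + y').
Proof.
move=> c0 x0 y0 n0 x'0 y'0 n'0 le1 le2.
suff : 2 * (c * (n * n')) <= x * y' + x' * y by nra.
have s0 : 0 <= x * y' + x' * y by rewrite addr_ge0 ?mulr_ge0.
have m0 : 0 <= 2 * (c * (n * n')) by rewrite !mulr_ge0.
rewrite -(@ler_pXn2r _ 2) // ?nnegrE //.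
have : (c * n ^+ 2) * (c * n' ^+ 2) <= (x * y) * (x' * y').
  by apply: ler_pM => //; rewrite mulr_ge0 ?sqr_ge0.
have : 0 <= (x * y' - x' * y) ^+ 2 by apply: sqr_ge0.
lra.
Qed.

Lemma cauchy_sum (I : finType) (P : pred I) (c : rat) (X Y n : I -> rat) :
    0 <= c -> (forall i, P i -> [/\ 0 <= X i, 0 <= Y i & 0 <= n i]) ->
    (forall i, P i -> c * n i ^+ 2 <= X i * Y i) ->
  c * (\sum_(i | P i) n i) ^+ 2 <= (\sum_(i | P i) X i) * (\sum_(i | P i) Y i).
Proof.
move=> c0 ge0 le.
suff [] : [/\ 0 <= \sum_(i | P i) X i, 0 <= \sum_(i | P i) Y i,
    0 <= \sum_(i | P i) n i & c * (\sum_(i | P i) n i) ^+ 2 <=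
    (\sum_(i | P i) X i) * (\sum_(i | P i) Y i)] by [].
elim/big_ind3: _ => [|x y n1 x' y' n' [x0 y0 n0 le1] [x'0 y'0 n'0 le2]|i Pi].
- by rewrite expr0n !mulr0.
- by split; rewrite ?addr_ge0 //; apply: cauchy_add.
by have [X0 Y0 n0] := ge0 i Pi; split=> //; apply: le.
Qed.

Section Step.

Variables (E : finType) (adj : rel E).
Hypothesis adjC : symmetric adj.
Implicit Types (B S R J : {set E}) (v w b e l : E).
Local Notation nbr := (nbr adj).
Local Notation alpha := (alpha adj).
Local Notation bipartite := (bipartite adj).

Definition mw B S := alpha B S * alpha (~: B) S.

Definition no_isolated S := [forall v in S, nbr S v != set0].

Definition leaves S v : {set E} := [set l in nbr S v | #|nbr S l| == 1%N].

Lemma mwC B S : mw (~: B) S = mw B S.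
Proof. by rewrite /mw setCK mulrC. Qed.

Lemma no_isolatedE B S : no_isolated S -> #|S|%:R * alpha B S = \sum_(w in S) alpha B (S :\ w).
Proof.
move=> /forall_inP fS; rewrite alphaE; apply: eq_bigr => w wS.
by rewrite /weight (negbTE (fS w wS)) mul1r.
Qed.

Lemma in_leaves S v l :
  (l \in leaves S v) = [&& l \in S, adj v l & #|nbr S l| == 1%N].
Proof. by rewrite !inE -andbA. Qed.

Lemma leaf_nbr S v l : v \in S -> l \in leaves S v -> nbr S l = [set v].
Proof.
move=> vS; rewrite in_leaves => /and3P[lS vl /cards1P[u nu]].
by move: (nu) => /setP/(_ v); rewrite !inE vS adjC vl => /esym/eqP->.
Qed.

Definition no_edge_component S :=
  {in S &, forall v w, adj v w -> (1 < #|nbr S v|)%N || (1 < #|nbr S w|)%N}.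

Lemma leaves_leaf S v l : no_edge_component S -> v \in S ->
  l \in leaves S v -> leaves S l = set0.
Proof.
move=> nK2 vS lv; have nl := leaf_nbr vS lv.
move: lv; rewrite in_leaves => /and3P[lS vl cl].
apply/setP=> u; rewrite in_leaves inE; apply/negbTE/and3P=> -[uS lu cu].
have : u \in nbr S l by rewrite in_nbr uS.
rewrite nl inE => /eqP uv; have := nK2 v l vS lS vl.
by rewrite -uv (eqP cu) (eqP cl).
Qed.

(** Each centre hands its term in equal shares to its leaves. Without single-edge components a leaf
    has no leaves of its own, so no share is handed on. *)
Lemma sum_leaves S (f : E -> rat) : no_edge_component S ->
  \sum_(w in S) f w = \sum_(w in S | leaves S w == set0)
     (f w + \sum_(v in S | w \in leaves S v) f v / #|leaves S v|%:R).
Proof.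
move=> nK2; rewrite big_split /= (bigID (fun w => leaves S w == set0)) /=.
congr (_ + _); rewrite (exchange_big_dep (fun v => (v \in S) && (leaves S v != set0))) /=.
  apply: eq_bigr => v /andP[vS vl]; rewrite (eq_bigl (mem (leaves S v))) /=.
    by rewrite sumr_const -[RHS]mulr_natr divfK // pnatr_eq0 cards_eq0.
  move=> l; rewrite vS /=; case: (boolP (l \in leaves S v)) => lv; last by rewrite andbF.
  rewrite (leaves_leaf nK2 vS lv) eqxx !andbT.
  by move: lv; rewrite in_leaves => /and3P[].
move=> l v /andP[lS l0] /andP[vS lv]; rewrite vS /=.
by apply/set0Pn; exists l.
Qed.

Lemma no_isolated_setD1 S w : no_isolated S -> leaves S w = set0 -> no_isolated (S :\ w).
Proof.
move=> /forall_inP fS lw; apply/forall_inP=> v; rewrite !inE => /andP[vw vS].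
rewrite nbrD1; apply/negP=> /eqP; move/eqP; rewrite setD_eq0 subset1.
rewrite (negbTE (fS v vS)) orbF => /eqP nv.
move/setP/(_ v): lw; rewrite in_leaves inE vS nv cards1 eqxx andbT /=.
by move/setP/(_ w): nv; rewrite in_nbr !inE eqxx adjC => /andP[_ ->].
Qed.

(* The deletion of the centre [v] of a star isolates its [k] leaves, so one of
   the two factors vanishes there; the contribution of [v] is shared out
   equally among these leaves before the Cauchy-Schwarz inequality is applied. *)
Lemma mw_step B S (c : rat) : 0 <= c -> S != set0 -> no_isolated S ->
    no_edge_component S ->
    (forall w, w \in S -> leaves S w = set0 -> (1 < #|nbr S w|)%N ->
      c <= mw B (S :\ w)) ->
    (forall v l, v \in S -> l \in leaves S v -> let k : rat := #|leaves S v|%:R in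
      c * (k + 1) ^+ 2 <= k ^+ 2 * mw B (S :\ l) +
        k * (alpha B (S :\ l) * alpha (~: B) (S :\ v)
             + alpha B (S :\ v) * alpha (~: B) (S :\ l))) ->
  c <= mw B S.
Proof.
move=> c0 S0 fS nK2 good leaf.
have N0 : 0 < #|S|%:R :> rat by rewrite ltr0n lt0n cards_eq0.
have N2 : 0 < #|S|%:R ^+ 2 :> rat by rewrite exprn_gt0.
rewrite -(ler_pM2r N2) /mw -mulrA.
have -> : alpha B S * (alpha (~: B) S * #|S|%:R ^+ 2) =
    (#|S|%:R * alpha B S) * (#|S|%:R * alpha (~: B) S) by ring.
(* [#|S|] is written as a sum of ones and regrouped in the same way: in the Cauchy-Schwarz step a
   leaf of a centre with [k] leaves carries [1 + 1 / k], a vertex that is neither leaf nor centre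
   carries 1. *)
rewrite !no_isolatedE // -[#|S|%:R]mulr_natl mulr1 -sumr_const !(sum_leaves _ nK2).
have sum_ge0 (f : E -> rat) w : (forall u, 0 <= f u) ->
    0 <= \sum_(v in S | w \in leaves S v) f v / #|leaves S v|%:R.
  by move=> f0; apply: sumr_ge0 => v _; rewrite divr_ge0.
apply: cauchy_sum => // w /andP[wS /eqP lw].
  by split; rewrite addr_ge0 ?alpha_ge0 ?sum_ge0 // => u; rewrite alpha_ge0.
have [w1|w1] := leqP #|nbr S w| 1; last first.
  have sum0 (f : E -> rat) :
      \sum_(v in S | w \in leaves S v) f v / #|leaves S v|%:R = 0.
    rewrite big_pred0 // => v; rewrite in_leaves.
    by rewrite [_ == 1%N]gtn_eqF // !andbF.
  by rewrite !sum0 !addr0 expr1n mulr1; apply: good.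
have cw : #|nbr S w| = 1%N.
  apply/eqP; rewrite eqn_leq w1 lt0n cards_eq0.
  by move/forall_inP: fS; apply.
have /cards1P[v nw] := introT eqP cw.
have : v \in nbr S w by rewrite nw set11.
rewrite in_nbr => /andP[vS wv].
have wl : w \in leaves S v by rewrite in_leaves wS adjC wv cw.
have sum1 (f : E -> rat) :
    \sum_(u in S | w \in leaves S u) f u / #|leaves S u|%:R = f v / #|leaves S v|%:R.
  rewrite (big_pred1 v) // => u; apply/andP/eqP=> [[uS wu]|->//].
  by have := leaf_nbr uS wu; rewrite nw => /set1_inj.
rewrite !sum1; have := leaf v w vS wl; rewrite /= /mw.
have k0 : 0 < #|leaves S v|%:R :> rat.
  by rewrite ltr0n lt0n cards_eq0; apply/set0Pn; exists w.
move: (#|leaves S v|%:R) k0 => k k0 le.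
have k2 : 0 < k ^+ 2 by rewrite exprn_gt0.
rewrite -(ler_pM2r k2).
have -> : c * (1 + 1 / k) ^+ 2 * k ^+ 2 = c * (k + 1) ^+ 2 by field; rewrite gt_eqF.
apply: le_trans le _.
set x := alpha B (S :\ w); set y := alpha _ (S :\ w).
set x' := alpha B (S :\ v); set y' := alpha _ (S :\ v).
have -> : (x + x' / k) * (y + y' / k) * k ^+ 2 =
  k ^+ 2 * (x * y) + k * (x * y' + x' * y) + x' * y' by field; rewrite gt_eqF.
(* The discarded [x' * y'] is in fact 0: deleting [v] isolates its leaf [w], which lies outside one
   of the two sides. *)
by rewrite lerDl mulr_ge0 ?alpha_ge0.
Qed.

End Step.

(* A leaf of a centre with [k] leaves and [d] other neighbours can be handled
   when [f] bounds the graph without that leaf and [g] the one without the star. *)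
Definition star_ok (c : rat) (k d : nat) (f g : rat) : Prop :=
  c * (k%:R + 1) ^+ 2 <= k%:R ^+ 2 * f + 2 ^+ k * (1 + k%:R / (d + k)%:R) * g
  \/ k = 1%N /\ 4 * c <= 3 * f.

(** * Passing from smaller graphs to larger ones *)

Section Ladder.

Variables (E : finType) (adj : rel E).
Hypothesis adjC : symmetric adj.
Implicit Types (B S R J : {set E}) (v w b e l : E).
Local Notation nbr := (nbr adj).
Local Notation alpha := (alpha adj).
Local Notation bipartite := (bipartite adj).
Local Notation no_isolated := (no_isolated adj).
Local Notation leaves := (leaves adj).
Local Notation mw := (mw adj).

Lemma bipartite_notin B v w : bipartite B -> adj v w -> v \in B -> w \notin B.
Proof. by move=> bip /bip vw vB; move: vw; rewrite vB; case: (w \in B). Qed.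

Lemma star_decomp B S v : bipartite B -> v \in S -> v \in B ->
  let J := leaves S v in let R := S :\ v :\: J in
  [/\ v \notin R, v \notin J, [disjoint J & B], [disjoint R & J]
    & v |: (R :|: J) = S].
Proof.
move=> bip vS vB J R.
have dJB : [disjoint J & B].
  rewrite disjoint_subset; apply/subsetP=> l; rewrite in_leaves !inE => /and3P[_ vl _].
  exact: bipartite_notin vl vB.
have vJ : v \notin J by apply/negP=> vJ; rewrite (disjointFr dJB vJ) in vB.
split=> //.
- by rewrite !inE eqxx andbF.
- by rewrite -setI_eq0 setIDAC -setIDA setDv setI0.
apply/setP=> u; rewrite in_setU1 in_setU in_setD in_setD1.
case: (eqVneq u v) => [->|uv] /=; first by rewrite vS.
by case: (boolP (u \in J)); rewrite ?orbT ?orbF //= in_leaves => /and3P[->].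
Qed.

(** Once [v] is gone its [k] leaves are isolated and count 2 each on their own side. On the side of
    [v], deleting [l] leaves a star with [k - 1] leaves, and [k] times its gain
    [1 / k + 1 / (d + k)] is the second factor. *)
Lemma star_le B S v l : bipartite B -> v \in S -> v \in B -> l \in leaves S v ->
  let k := #|leaves S v| in let R := S :\ v :\: leaves S v in
  2 ^+ k * (1 + k%:R / (#|nbr R v| + k)%:R) * mw B R <=
    k%:R * (alpha B (S :\ l) * alpha (~: B) (S :\ v)).
Proof.
move=> bip vS vB lv; cbv zeta; set J := leaves S v; set R := S :\ v :\: J.
have [vR vJ dJB dRJ SE] := star_decomp bip vS vB.
rewrite -/J -/R in vR vJ dJB dRJ SE.
have leafJ j : j \in J -> nbr S j = [set v] by apply: leaf_nbr.
have -> : alpha (~: B) (S :\ v) = 2 ^+ #|J| * alpha (~: B) R.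
  apply: alpha_isolated_set => //.
  - apply/subsetP=> j jJ; rewrite !inE; apply/andP; split.
      by apply: contraNneq vJ => <-.
    by move: jJ; rewrite in_leaves => /andP[].
  - by rewrite -disjoints_subset.
  by move=> j jJ; rewrite nbrD1 leafJ // setDv.
have cJ : #|J| = #|J :\ l|.+1 by rewrite (cardsD1 l) lv.
have lR : l \notin R by rewrite (disjointFl dRJ).
have lv' : l != v by apply: contraNneq vJ => <-.
have SlE : S :\ l = v |: (R :|: (J :\ l)).
  rewrite -{1}SE; apply/setP=> u; rewrite in_setD1 !in_setU1 !in_setU in_setD1.
  by case: (eqVneq u l) => [->|_] //=; rewrite (negbTE lv') (negbTE lR).
have : gain #|J :\ l| #|nbr R v| * alpha B R <= alpha B (S :\ l).
  rewrite SlE; apply: alpha_star_ge => //.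
  - by rewrite inE negb_and vJ orbT.
  - exact: disjointWl (subsetDl _ _) dJB.
  - exact: disjointWr (subsetDl _ _) dRJ.
  move=> j; rewrite inE => /andP[jl jJ]; rewrite -SlE nbrD1 leafJ //.
  by apply/setDidPl; rewrite disjoints1 inE eq_sym.
rewrite /mw /gain cJ !addnS.
have a0 := alpha_ge0 adj (~: B) R.
move: (alpha _ R) (alpha _ R) (alpha _ (S :\ l)) a0 => a b a' b0 le.
move: #|J :\ l| #|nbr R v| le => i d le.
have i0 : 0 <= i%:R :> rat by []. have d0 : 0 <= d%:R :> rat by [].
have := ler_wpM2r (mulr_ge0 (ler0n _ i.+1) (mulr_ge0 (exprn_ge0 i.+1 (ler0n rat 2)) b0)) le.
move: (2 ^+ i.+1) => z.
suff -> : (i.+1%:R^-1 + (d + i).+1%:R^-1) * a * (i.+1%:R * (z * b)) =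
  z * (1 + i.+1%:R / (d + i).+1%:R) * (a * b).
  by move=> h; apply: le_trans h _; rewrite le_eqVlt; apply/orP; left; apply/eqP; ring.
rewrite -!natr1 natrD.
by field; rewrite !gt_eqF //; lra.
Qed.

(** After the deletion of [v] the only leaf [l] counts 2, and dropping [v] from [S :\ l] does not
    decrease the value on the side without [v]. Together with the term of [l] this gives [3 * f]
    against [4 * c], the second alternative of [star_ok]. *)
Lemma star1_le B S v l : bipartite B -> v \in S -> v \in B -> l \in leaves S v ->
  #|leaves S v| = 1%N ->
  2 * mw B (S :\ l) <= alpha B (S :\ l) * alpha (~: B) (S :\ v).
Proof.
move=> bip vS vB lv c1.
have nl := leaf_nbr adjC vS lv.
have [lS vl] : l \in S /\ adj v l by move: lv; rewrite in_leaves => /and3P[].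
have lB := bipartite_notin bip vl vB.
have lv' : l != v by apply: contraNneq lB => ->.
rewrite (@alpha_isolated _ _ adjC (~: B) (S :\ v) l) ?inE ?lv' ?lB //; last first.
  by rewrite nbrD1 nl setDv.
rewrite /mw mulrCA ler_wpM2l ?alpha_ge0 // ler_wpM2l //.
have -> : S :\ v :\ l = S :\ l :\ v by rewrite !setDDl setUC.
apply: alpha_setD1_ge; first exact: bipartiteC.
  by rewrite !inE eq_sym lv'.
by rewrite inE negbK.
Qed.

Lemma mw_star B S (c : rat) : bipartite B -> 0 <= c -> S != set0 -> no_isolated S ->
    no_edge_component adj S ->
    (forall w, w \in S -> no_isolated (S :\ w) -> c <= mw B (S :\ w)) ->
    (forall v l, v \in S -> l \in leaves S v ->
      let k := #|leaves S v| in let R := S :\ v :\: leaves S v in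
      star_ok c k #|nbr R v| (mw B (S :\ l)) (mw B R)) ->
  c <= mw B S.
Proof.
move=> bip c0 S0 fS nK2 good star; apply: mw_step => //.
  by move=> w wS lw _; apply: good => //; apply: no_isolated_setD1.
move=> v l vS lv; cbv zeta; set k : rat := #|leaves S v|%:R.
have k0 : 0 <= k by [].
(* Of the two mixed products only the one pairing the side of [v] with the deletion of [l] is
   nonzero; calling that side [B'] treats both positions of [v] at once. *)
suff H : forall B', (B' = B) \/ (B' = ~: B) -> v \in B' ->
    c * (k + 1) ^+ 2 <= k ^+ 2 * mw B (S :\ l) +
      k * (alpha B' (S :\ l) * alpha (~: B') (S :\ v)).
  have [vB|vB] := boolP (v \in B).
    apply: le_trans (H B (or_introl erefl) vB) _.
    by rewrite lerD2l ler_wpM2l // lerDl mulr_ge0 ?alpha_ge0.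
  have vCB : v \in ~: B by rewrite inE.
  apply: le_trans (H (~: B) (or_intror erefl) vCB) _; rewrite setCK.
  rewrite lerD2l ler_wpM2l // [X in _ <= X]addrC [alpha B (S :\ v) * _]mulrC.
  by rewrite lerDl mulr_ge0 ?alpha_ge0.
move=> B' B'E vB'.
have bip' : bipartite B' by case: B'E => ->; [|apply: bipartiteC].
have mwE T : mw B' T = mw B T by case: B'E => -> //; rewrite mwC.
have [le|[k1 le]] := star v l vS lv.
  apply: le_trans le _; rewrite lerD2l -mwE; exact: star_le.
have := star1_le bip' vS vB' lv k1; rewrite mwE /k k1 => le'.
by rewrite !expr1n; lra.
Qed.

Definition lower r m c := forall B S, bipartite B -> no_isolated S ->
  #|S :&: B| = r -> #|S :\: B| = m -> c <= mw B S.

Lemma lowerC r m c : lower r m c -> lower m r c.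
Proof.
move=> low B S bip fS cB cC; rewrite -mwC; apply: low => //.
- exact: bipartiteC.
- by rewrite -setDE.
by rewrite setDE setCK.
Qed.

Lemma lowerW r m c c' : c' <= c -> lower r m c -> lower r m c'.
Proof. by move=> le low B S bip fS cB cC; apply: le_trans le _; apply: low. Qed.

Lemma lower00 : lower 0 0 1.
Proof.
move=> B S bip fS /eqP; rewrite cards_eq0 => /eqP s1 /eqP; rewrite cards_eq0 => /eqP s2.
have -> : S = set0 by rewrite -(setID S B) s1 s2 setU0.
by rewrite /mw !alpha0 mulr1.
Qed.

(** Vacuous for every [c]: a vertex outside [B] would need a neighbour inside. *)
Lemma lower0S m c : lower 0 m.+1 c.
Proof.
move=> B S bip fS /eqP; rewrite cards_eq0 => /eqP s1 s2.
have [e] : exists e, e \in S :\: B by apply/set0Pn; rewrite -card_gt0 s2.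
rewrite inE => /andP[eB eS].
have /set0Pn[b] := forall_inP fS e eS; rewrite in_nbr => /andP[bS /bip].
have: b \notin S :&: B by rewrite s1 inE.
by rewrite inE bS /= => bB; rewrite (negbTE eB) (negbTE bB).
Qed.

Lemma card_IDset S B w : w \in S ->
  #|S :&: B| = ((w \in B) + #|(S :\ w) :&: B|)%N /\
  #|S :\: B| = ((w \notin B) + #|(S :\ w) :\: B|)%N.
Proof.
move=> wS; rewrite (cardsD1 w (S :&: B)) (cardsD1 w (S :\: B)) !inE wS andbT.
split; congr (_ + #|pred_of_set _|)%N; apply/setP=> u; rewrite !inE; first by rewrite andbA.
by rewrite andbCA.
Qed.

Lemma star_ok_mono (c : rat) k d f g f' g' :
  star_ok c k d f g -> f <= f' -> g <= g' -> star_ok c k d f' g'.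
Proof.
move=> [le|[k1 le]] ff gg; [left|by right; split=> //; lra].
apply: le_trans le (lerD _ _); first by rewrite ler_wpM2l ?sqr_ge0.
by rewrite ler_wpM2l // mulr_ge0 ?exprn_ge0 // addr_ge0 ?divr_ge0.
Qed.

Lemma star_card B S v : bipartite B -> v \in S -> v \in B ->
  let J := leaves S v in let R := S :\ v :\: J in
  [/\ #|S :&: B| = #|R :&: B|.+1, #|S :\: B| = (#|J| + #|R :\: B|)%N,
    (#|nbr R v| <= #|R :\: B|)%N & #|nbr S v| = (#|J| + #|nbr R v|)%N].
Proof.
move=> bip vS vB J R.
have [vR vJ dJB dRJ SE] := star_decomp bip vS vB.
rewrite -/J -/R in vR vJ dJB dRJ SE.
have RJ u : u \in R -> u \notin J by move=> uR; rewrite (disjointFr dRJ uR).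
have JB u : u \in J -> u \notin B by move=> uJ; rewrite (disjointFr dJB uJ).
have cardJU (A : {set E}) : A \subset R -> #|J :|: A| = (#|J| + #|A|)%N.
  move=> AR; apply/eqP; rewrite (leq_card_setU J A).2 disjoint_sym.
  exact: disjointWl AR dRJ.
have inS u : (u \in S) = [|| u == v, u \in R | u \in J].
  by rewrite -{1}SE in_setU1 in_setU.
have adjJ u : u \in J -> adj v u by rewrite in_leaves => /and3P[].
clearbody R J; split.
- rewrite (cardsD1 v) in_setI vS vB add1n; congr _.+1; congr #|pred_of_set _|.
  apply/setP=> u; rewrite in_setD1 !in_setI inS.
  case: (eqVneq u v) => [->|_] /=; first by rewrite (negbTE vR).
  by case: (boolP (u \in J)) => [/JB/negbTE->|]; rewrite ?andbF ?orbF.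
- rewrite -cardJU ?subsetDl //; congr #|pred_of_set _|.
  apply/setP=> u; rewrite in_setU !in_setD inS; case: (eqVneq u v) => [->|_] /=.
    by rewrite vB (negbTE vJ).
  case: (boolP (u \in J)) => [/JB/negbTE->|]; rewrite ?orbT ?orbF //.
- apply: subset_leq_card; apply/subsetP=> u; rewrite in_nbr !in_setD => /andP[-> vu].
  by rewrite (bipartite_notin bip vu vB).
rewrite -cardJU; last by apply/subsetP=> u; rewrite in_nbr => /andP[].
congr #|pred_of_set _|; apply/setP=> u; rewrite !in_setU !in_nbr inS.
case: (eqVneq u v) => [->|_] /=.
  rewrite (negbTE vJ) (negbTE vR) /=.
  by apply/negbTE/negP=> /bip; rewrite eqxx.
case: (boolP (u \in J)) => [|_]; last by rewrite orbF.
by rewrite orbT => /adjJ.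
Qed.

(** Leaves of [v] see only [v], so a vertex isolated by removing the star had [v] as its only
    neighbour and was a leaf itself. *)
Lemma no_isolated_star S v : v \in S -> no_isolated S -> no_isolated (S :\ v :\: leaves S v).
Proof.
move=> vS fS; apply/forall_inP=> u; rewrite in_setD in_setD1 => /and3P[uJ uv uS].
apply/negP=> /eqP nu.
suff nuv : nbr S u = [set v].
  have : v \in nbr S u by rewrite nuv set11.
  rewrite in_nbr adjC => /andP[_ vu].
  by case/negP: uJ; rewrite in_leaves uS vu nuv cards1.
have /set0Pn nu0 := forall_inP fS u uS.
have sub : nbr S u \subset [set v].
  apply/subsetP=> w; rewrite in_nbr inE => /andP[wS uw].
  apply/negPn/negP=> wv; move/setP/(_ w): nu; rewrite in_nbr uw andbT in_set0.
  rewrite in_setD in_setD1 wS wv !andbT => /negbT; rewrite negbK => wJ.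
  have : u \in nbr S w by rewrite in_nbr uS adjC.
  by rewrite (leaf_nbr adjC vS wJ) inE (negbTE uv).
by apply/eqP; rewrite eqEsubset sub sub1set; case: nu0 => w wn;
   rewrite -(set1P (subsetP sub w wn)).
Qed.

(** Either a single-edge component splits off with factor 1, or [mw_star] applies: vertices are
    deleted on each side, and stars have their centre inside [B] (first condition) or outside
    (second). Their centres have degree [k + d > 1], as no single edge is left. *)
Lemma lower_ladder r m c : 0 <= c ->
    lower r m c -> lower r.+1 m c -> lower r m.+1 c ->
    (forall k d, (0 < k <= m.+1)%N -> (d <= m.+1 - k)%N -> (1 < k + d)%N ->
      exists f g, [/\ lower r.+1 m f, lower r (m.+1 - k) g & star_ok c k d f g]) ->
    (forall k d, (0 < k <= r.+1)%N -> (d <= r.+1 - k)%N -> (1 < k + d)%N ->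
      exists f g, [/\ lower r m.+1 f, lower (r.+1 - k) m g & star_ok c k d f g]) ->
  lower r.+1 m.+1 c.
Proof.
move=> c0 low00 low10 low01 starB starC B S bip fS cB cC.
have S0 : S != set0 by apply: contra_eq_neq cB => ->; rewrite set0I cards0.
have bip' := bipartiteC bip.
have [|nK2] := boolP [exists b in S :&: B, [exists e in S,
    [&& adj b e, nbr S b == [set e] & nbr S e == [set b]]]].
  case/exists_inP=> b /setIP[bS bB] /exists_inP[e eS /and3P[be /eqP nb /eqP ne]].
  have eB := bipartite_notin bip be bB.
  have eB' : e \in ~: B by rewrite inE.
  have eb : e != b by apply: contraNneq eB => ->.
  have -> : mw B S = mw B (S :\ b :\ e).
    rewrite /mw (alpha_edge adjC bip bS eS bB nb ne).
    rewrite (alpha_edge adjC bip' eS bS eB' ne nb).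
    by rewrite [S :\ e :\ b]setDDl setUC -setDDl.
  have eSb : e \in S :\ b by rewrite !inE eb.
  have [c1 c2] := card_IDset B bS; have [c3 c4] := card_IDset B eSb.
  apply: low00 => //.
  - apply/forall_inP=> u; rewrite !inE => /and3P[ue ub uS].
    suff -> : nbr (S :\ b :\ e) u = nbr S u by apply: forall_inP fS u uS.
    have nbu : ~~ adj b u.
      by apply/negP=> bu; move/setP/(_ u): nb; rewrite in_nbr !inE uS bu (negbTE ue).
    have neu : ~~ adj e u.
      by apply/negP=> eu; move/setP/(_ u): ne; rewrite in_nbr !inE uS eu (negbTE ub).
    rewrite !nbrD1; apply/setP=> w; rewrite !in_setD1 in_nbr.
    case: (eqVneq w e) => [->|_]; first by rewrite adjC (negbTE neu) andbF.
    by case: (eqVneq w b) => [->|//]; rewrite adjC (negbTE nbu) andbF.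
  - by rewrite bB (negbTE eB) /= in c1 c3; clear -cB c1 c3; lia.
  by rewrite bB eB /= in c2 c4; clear -cC c2 c4; lia.
have noK2 : no_edge_component adj S.
  suff H v w : v \in S -> w \in S -> adj v w -> v \in B ->
      (1 < #|nbr S v|)%N || (1 < #|nbr S w|)%N.
    move=> v w vS wS vw; have [vB|vB] := boolP (v \in B); first exact: H.
    rewrite orbC; apply: H => //; first by rewrite adjC.
    by move/bip: vw; rewrite (negbTE vB); case: (w \in B).
  move=> vS wS vw vB; apply: contraR nK2; rewrite negb_or -!leqNgt => /andP[v1 w1].
  apply/exists_inP; exists v; first by rewrite inE vS.
  apply/exists_inP; exists w => //; rewrite vw /=.
  rewrite ![_ == [set _]]eq_sym !eqEcard !cards1 v1 w1 !sub1set !in_nbr.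
  by rewrite vS wS vw adjC vw.
apply: mw_star => // [w wS fw|v l vS lv k R].
  have [c1 c2] := card_IDset B wS.
  have [wB|wB] := boolP (w \in B).
    by rewrite wB /= in c1 c2; apply: low01 => //; clear -cB cC c1 c2; lia.
  rewrite wB (negbTE wB) /= in c1 c2.
  by apply: low10 => //; clear -cB cC c1 c2; lia.
have fR : no_isolated R by apply: no_isolated_star.
have [lS vl] : l \in S /\ adj v l by move: lv; rewrite in_leaves => /and3P[].
have nl := leaf_nbr adjC vS lv.
have fl : no_isolated (S :\ l) by apply: no_isolated_setD1 => //; apply: leaves_leaf lv.
have k0 : (0 < k)%N by rewrite card_gt0; apply/set0Pn; exists l.
have [c1 c2] := card_IDset B lS.
have v1 : (1 < #|nbr S v|)%N by have := noK2 v l vS lS vl; rewrite nl cards1 orbF.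
have [vB|vB] := boolP (v \in B).
  have [cB1 cC1 d1 n1] := star_card bip vS vB; rewrite -/k -/R in cB1 cC1 d1 n1.
  have lB := bipartite_notin bip vl vB; rewrite lB (negbTE lB) /= in c1 c2.
  have [|||f [g [lf lg ok]]] := starB k #|nbr R v|.
  1-3: clear -k0 cB cC cB1 cC1 d1 n1 v1; lia.
  by apply: star_ok_mono ok (lf _ _ _ _ _ _) (lg _ _ _ _ _ _) => //;
     clear -cB cC cB1 cC1 c1 c2; lia.
have vB' : v \in ~: B by rewrite inE.
have [cB1 cC1 d1 n1] := star_card bip' vS vB'; rewrite -/k -/R in cB1 cC1 d1 n1.
rewrite -!setDE !setDE !setCK in cB1 cC1 d1.
rewrite -!setDE in cB1.
have lB : l \in B by move/bip: vl; rewrite (negbTE vB); case: (l \in B).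
rewrite lB /= in c1 c2.
have [|||f [g [lf lg ok]]] := starC k #|nbr R v|.
1-3: clear -k0 cB cC cB1 cC1 d1 n1 v1; lia.
by apply: star_ok_mono ok (lf _ _ _ _ _ _) (lg _ _ _ _ _ _) => //;
   clear -cB cC cB1 cC1 c1 c2; lia.
Qed.

End Ladder.

(** * The computed bounds *)

(* A bipartite graph is given by its number of rows (vertices in B) and by the
   sorted list of its columns (neighbourhoods of the vertices outside B). The
   table stores the values at (2,0) and (0,2) multiplied by the factorial of the
   number of vertices, which makes them integers. *)
Definition columns := seq bitseq.

Fixpoint lexb (s t : bitseq) : bool :=
  match s, t with
  | [::], _ => true
  | a :: s', b :: t' => if a == b then lexb s' t' else b
  | _, _ => false
  end.

Definition del_row i (s : bitseq) : bitseq := take i s ++ drop i.+1 s.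

Fixpoint picks (T : Type) (s : seq T) : seq (T * seq T) :=
  if s is x :: s' then (x, s') :: [seq (p.1, x :: p.2) | p <- picks s'] else [::].

(** The unary prefix gives the number of rows, and a marker before each column shows where the list
    ends, so columns of the right length can be read back. *)
Definition key r (cols : columns) : bitseq :=
  nseq r false ++ true :: flatten [seq true :: c | c <- cols].

Definition entry := (N * N)%type.

Inductive trie := Leaf | Node of option entry & trie & trie.

Fixpoint trie_get t (k : bitseq) : option entry :=
  match t, k with
  | Leaf, _ => None
  | Node e _ _, [::] => e
  | Node _ t0 t1, b :: k' => trie_get (if b then t1 else t0) k'
  end.

Fixpoint trie_put t (k : bitseq) (e : entry) : trie :=
  match t, k with
  | Leaf, [::] => Node (Some e) Leaf Leaf
  | Node _ t0 t1, [::] => Node (Some e) t0 t1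
  | Leaf, b :: k' =>
      if b then Node None Leaf (trie_put Leaf k' e)
      else Node None (trie_put Leaf k' e) Leaf
  | Node o t0 t1, b :: k' =>
      if b then Node o t0 (trie_put t1 k' e) else Node o (trie_put t0 k' e) t1
  end.

Definition look t r (cols : columns) := trie_get t (key r cols).

Definition scale (a b : N) (o : option entry) :=
  if o is Some (x, y) then Some (N.mul a x, N.mul b y) else None.

(** A missing entry makes the whole sum missing, so a gap in the table cannot pass for a zero. *)
Definition sum_opt (l : seq (option entry)) :=
  foldr (fun o acc => if o is Some (x, y) then
      if acc is Some (x', y') then Some (N.add x x', N.add y y') else None
    else None) (Some (N0, N0)) l.

Definition bin_weight (isolated inside : bool) : N :=
  N.of_nat (if isolated then if inside then 2 else 0 else 1).

Definition row_isolated i (cols : columns) := ~~ has (fun c => nth false c i) cols.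
Definition col_isolated (c : bitseq) := ~~ has id c.

(** Deleting a row may disturb the order of the columns, hence the [sort]; deleting a column does
    not. *)
Definition row_term t r cols i :=
  scale (bin_weight (row_isolated i cols) true) (bin_weight (row_isolated i cols) false)
    (look t r.-1 (sort lexb [seq del_row i c | c <- cols])).

Definition col_term t r (p : bitseq * columns) :=
  scale (bin_weight (col_isolated p.1) false) (bin_weight (col_isolated p.1) true)
    (look t r p.2).

Definition compute t r (cols : columns) :=
  if eqn r 0 && nilp cols then Some (N.of_nat 1, N.of_nat 1) else
  sum_opt ([seq row_term t r cols i | i <- iota 0 r] ++ [seq col_term t r p | p <- picks cols]).

Definition extend t (rc : nat * columns) :=
  if compute t rc.1 rc.2 is Some v then trie_put t (key rc.1 rc.2) v else t.

Fixpoint bits r : seq bitseq :=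
  if r is r'.+1 then [seq false :: s | s <- bits r'] ++ [seq true :: s | s <- bits r']
  else [:: [::]].

(** The elements come in the order of [ts], which for [bits r] is that of [lexb]; this lets the
    look-ups succeed, while soundness holds for any order. *)
Fixpoint multisets (T : Type) (ts : seq T) (m : nat) : seq (seq T) :=
  if ts is t :: ts' then
    flatten [seq [seq nseq k t ++ s | s <- multisets ts' (m - k)] | k <- iota 0 m.+1]
  else if m is 0 then [:: [::]] else [::].

Definition fill r ts t m : trie :=
  foldl extend t [seq (r, cols) | cols <- multisets ts m].

(** For four rows these columns suffice: deleting a column leaves only such columns, and deleting a
    row leads to the three-row table, which has all columns. *)
Definition covering_bits r := [seq c <- bits r | ~~ col_isolated c].

(* The ranges are parameters so that simplification cannot start computing the
   table; only the check of the bounds instantiates them. *)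
Definition table (rs ms ms4 : seq nat) : trie :=
  let t := foldl (fun t r => foldl (fill r (bits r)) t ms) Leaf rs in
  foldl (fill 4 (covering_bits 4)) t ms4.

Fixpoint bin_fact n : N :=
  if n is n'.+1 then N.mul (N.of_nat n) (bin_fact n') else N.of_nat 1.

Definition check t r m (p q : nat) : bool :=
  let f := bin_fact (r + m) in
  all (fun cols => has (fun i => row_isolated i cols) (iota 0 r) ||
    if look t r cols is Some (x, y) then
      N.leb (N.mul (N.of_nat p) (N.mul f f)) (N.mul (N.of_nat q) (N.mul x y))
    else false)
  (multisets (covering_bits r) m).

(** * Soundness of the table *)

Lemma perm_map_ex (T U : eqType) (f : T -> U) (s : seq T) (t : seq U) :
  perm_eq (map f s) t -> exists2 s', perm_eq s s' & t = map f s'.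
Proof.
elim: t s => [|c t IHt] s st.
  by exists [::] => //; move/perm_size: st; case: s.
have : c \in map f s by rewrite (perm_mem st) mem_head.
case/mapP=> x xs cE; rewrite cE in st *.
have {}st : perm_eq (map f (rem x s)) t.
  by rewrite -(perm_cons (f x)) -map_cons (perm_trans _ st) // perm_map // perm_sym perm_to_rem.
have [s' ss' ->] := IHt _ st; exists (x :: s') => //.
by rewrite (perm_trans (perm_to_rem xs)) // perm_cons.
Qed.

Lemma picks_map (T U : Type) (f : T -> U) s :
  picks (map f s) = [seq (f p.1, map f p.2) | p <- picks s].
Proof. by elim: s => //= x s ->; rewrite -!map_comp. Qed.

Lemma picks_fst (T : Type) (s : seq T) : [seq p.1 | p <- picks s] = s.
Proof. by elim: s => //= x s IHs; rewrite -map_comp -{2}IHs. Qed.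

Lemma picks_perm (T : eqType) (s : seq T) p : p \in picks s -> perm_eq (p.1 :: p.2) s.
Proof.
elim: s p => //= x s IHs p; rewrite inE => /predU1P[->//|/mapP[q qs ->]] /=.
apply: (@perm_trans _ (x :: (q.1 :: q.2))); last by rewrite perm_cons IHs.
by rewrite -cat1s -[x :: q.1 :: _]cat1s -[x :: q.2]cat1s -[q.1 :: q.2]cat1s perm_catCA.
Qed.

Definition opt1 (o : option entry) : rat := if o is Some v then (N.to_nat v.1)%:R else 0.
Definition opt2 (o : option entry) : rat := if o is Some v then (N.to_nat v.2)%:R else 0.

Lemma sum_optP l v : sum_opt l = Some v ->
  [/\ all isSome l, (N.to_nat v.1)%:R = \sum_(o <- l) opt1 o
    & (N.to_nat v.2)%:R = \sum_(o <- l) opt2 o].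
Proof.
elim: l v => [|[[x y]|] l IHl] [x1 y1] //=; first by case=> <- <-; rewrite !big_nil.
case: (sum_opt l) IHl => [[x' y']|] // /(_ _ erefl)[-> /= h1 h2] [<- <-].
by rewrite !big_cons -h1 -h2 /= !N2Nat.inj_add !plusE !natrD.
Qed.

Definition code (E : finType) (adj : rel E) (bs es : seq E) : columns :=
  [seq [seq adj b e | b <- bs] | e <- es].

Definition represents r (cols : columns) (v : entry) : Prop :=
  forall (E : finType) (adj : rel E) (B : {set E}) (bs es : seq E),
    symmetric adj -> bipartite adj B -> uniq bs -> uniq es ->
    {in bs, forall x, x \in B} -> {in es, forall x, x \notin B} ->
    size bs = r -> perm_eq (code adj bs es) cols ->
  (N.to_nat v.1)%:R = (size bs + size es)`!%:R * pt adj 2 0 B [set x in bs ++ es] /\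
  (N.to_nat v.2)%:R = (size bs + size es)`!%:R * pt adj 0 2 B [set x in bs ++ es].

Section PtRec.

Variables (E : finType) (adj : rel E) (B : {set E}) (bs es : seq E).
Hypothesis adjC : symmetric adj.
Hypothesis bip : bipartite adj B.
Hypotheses (ubs : uniq bs) (ues : uniq es).
Hypotheses (bsB : {in bs, forall x, x \in B}) (esB : {in es, forall x, x \notin B}).

Let S := [set x in bs ++ es].

Lemma uniq_bs_es : uniq (bs ++ es).
Proof.
rewrite cat_uniq ubs ues andbT; apply/hasPn=> x xe.
by apply/negP=> /bsB; rewrite (negbTE (esB xe)).
Qed.

(** The factorial absorbs the division in the recursion, which makes it one between integers; by
    bipartiteness isolation is tested against the opposite side only. *)
Lemma pt_fact_rec x y n : (size bs + size es)%N = n.+1 ->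
  n.+1`!%:R * pt adj x y B S =
  \sum_(b <- bs) (if has (adj b) es then 1 else x) * (n`!%:R * pt adj x y B (S :\ b)) +
  \sum_(e <- es) (if has (adj e) bs then 1 else y) * (n`!%:R * pt adj x y B (S :\ e)).
Proof.
move=> sz; have cS : #|S| = n.+1.
  by rewrite cardsE; have /card_uniqP -> := uniq_bs_es; rewrite size_cat.
rewrite factS natrM -mulrA [n`!%:R * _]mulrC mulrA -cS ptE mulr_suml.
rewrite (eq_bigl (mem (bs ++ es))); last by move=> v; rewrite inE.
rewrite -(big_uniq _ uniq_bs_es) big_cat /=.
have nbr0 v : (nbr adj S v == set0) = ~~ has (adj v) (bs ++ es).
  apply/eqP/hasPn=> [nv w wS|nv].
    by apply/negP=> vw; move/setP/(_ w): nv; rewrite !inE vw wS.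
  by apply/setP=> w; rewrite !inE; apply/negbTE/andP=> -[/nv /negbTE->].
congr (_ + _); apply: eq_big_seq => v vs; rewrite /weight nbr0 has_cat -mulrA.
  rewrite bsB // [has (adj v) bs](introF hasP) /=; last first.
    by case=> w ws /bip; rewrite !bsB.
  by rewrite [_ * n`!%:R]mulrC; case: (has (adj v) es).
rewrite (negbTE (esB vs)) [has (adj v) es](introF hasP) ?orbF /=; last first.
  by case=> w ws /bip; rewrite !(negbTE (esB _)).
by rewrite [_ * n`!%:R]mulrC; case: (has (adj v) bs).
Qed.

End PtRec.

(** [Q] holds for every stored entry; it is shifted along the path, so that the key is read from the
    root. *)
Fixpoint trie_inv (t : trie) (Q : bitseq -> entry -> Prop) : Prop :=
  if t is Node o t0 t1 then
    [/\ forall v, o = Some v -> Q [::] v,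
        trie_inv t0 (fun k => Q (false :: k)) & trie_inv t1 (fun k => Q (true :: k))]
  else True.

Lemma trie_inv_get t Q k v : trie_inv t Q -> trie_get t k = Some v -> Q k v.
Proof.
elim: t Q k => [|o t0 IH0 t1 IH1] Q [|b k] //= [inv_o inv0 inv1]; first exact: inv_o.
by case: b => [/(IH1 _ _ inv1)|/(IH0 _ _ inv0)].
Qed.

Lemma trie_inv_put t Q k v : trie_inv t Q -> Q k v -> trie_inv (trie_put t k v) Q.
Proof.
elim: k t Q => [|b k IHk] [|o t0 t1] Q //=.
- by move=> _ Qv; split=> // u [<-].
- by case=> _ inv0 inv1 Qv; split=> // u [<-].
- by case: b => _ Qv /=; split=> //; apply: IHk.
by case: b => -[inv_o inv0 inv1] Qv /=; split=> //; apply: IHk.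
Qed.

Lemma key_inj r r' cols cols' :
    all (fun c => size c == r) cols -> all (fun c => size c == r') cols' ->
  key r cols = key r' cols' -> r = r' /\ cols = cols'.
Proof.
move=> szc szc' eqk.
have [eqr eqf] : r = r' /\ flatten [seq true :: c | c <- cols]
    = flatten [seq true :: c | c <- cols'].
  move: eqk; rewrite /key; elim: r r' {szc szc'} => [|r IHr] [|r'] //=; first by case.
  by case=> /IHr[-> ->].
split=> //; rewrite -eqr in szc'.
elim: cols cols' szc szc' {eqk} eqf => [|c cols IHc] [|c' cols'] //=.
case/andP=> /eqP sc szc /andP[/eqP sc' szc'] [] /eqP.
by rewrite eqseq_cat ?sc ?sc' // => /andP[/eqP-> /eqP/IHc->].
Qed.

Definition sound_entry k v :=
  forall r cols, all (fun c => size c == r) cols -> key r cols = k -> represents r cols v.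

Lemma size_del_row i r (c : bitseq) : (i < r)%N -> size c = r -> size (del_row i c) = r.-1.
Proof.
move=> ir sc; rewrite size_cat size_drop size_take sc ir; lia.
Qed.

Lemma to_nat_scale (a b : N) o :
  (opt1 (scale a b o) = (N.to_nat a)%:R * opt1 o) *
  (opt2 (scale a b o) = (N.to_nat b)%:R * opt2 o).
Proof.
by case: o => [[x y]|] /=; rewrite ?mulr0 // !N2Nat.inj_mul !multE !natrM.
Qed.

Lemma bin_weightE iso ins :
  (N.to_nat (bin_weight iso ins))%:R = (if iso then if ins then 2 else 0 else 1) :> rat.
Proof. by rewrite /bin_weight Nat2N.id; case: iso; case: ins. Qed.

(** The vertices outside [B] are reordered so that their code is [cols] itself; the sums over rows
    and picks then match the two sums of [pt_fact_rec] term by term. *)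
Lemma compute_sound t r cols v : trie_inv t sound_entry ->
    all (fun c => size c == r) cols -> compute t r cols = Some v ->
  represents r cols v.
Proof.
move=> inv szc cv E adj B bs es adjC bip ubs ues bsB esB sbs pc.
have [es' pes colsE] := perm_map_ex pc.
have -> : [set x in bs ++ es] = [set x in bs ++ es'].
  by apply/setP=> x; rewrite !inE !mem_cat (perm_mem pes).
have ues' : uniq es' by rewrite -(perm_uniq pes).
have esB' : {in es', forall x, x \notin B}.
  by move=> x; rewrite -(perm_mem pes); apply: esB.
rewrite (perm_size pes) => {es ues esB pc pes}.
move: cv; rewrite /compute; case: ifP => [/andP[/eqP r0 /nilP c0] [<-]|nil0].
  have -> : bs = [::] by apply/nilP; rewrite /nilp sbs r0.
  have -> : es' = [::].
    apply/nilP; rewrite /nilp -(size_map (fun e => [seq adj b e | b <- bs])).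
    by rewrite -colsE c0.
  have -> : [set x in [::] ++ [::]] = set0 :> {set E} by apply/setP=> x; rewrite !inE.
  by rewrite !pt0 !mulr1.
move/sum_optP; rewrite all_cat !all_map => -[/andP[/allP okr /allP okc] -> ->].
have sz : exists n, (size bs + size es')%N = n.+1.
  case E1: (size bs + size es')%N => [|n]; last by exists n.
  move/eqP: E1 nil0; rewrite addn_eq0 sbs colsE => /andP[/eqP-> /eqP/size0nil->].
  by [].
have [n szn] := sz.
have [x0 _] : exists x0 : E, true.
  have : size (bs ++ es') = n.+1 by rewrite size_cat.
  by case: (bs ++ es') => // x l _; exists x.
have srow (F : E -> rat) : \sum_(b <- bs) F b = \sum_(i <- iota 0 r) F (nth x0 bs i).
  by rewrite -(big_map (nth x0 bs) predT) /= map_nth_iota0 -?sbs // take_size.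
have scol (F : E -> rat) : \sum_(e <- es') F e = \sum_(p <- picks es') F p.1.
  by rewrite -(big_map fst predT) /= picks_fst.
rewrite szn !(pt_fact_rec bip ubs ues' bsB esB' _ _ szn) !srow !scol.
rewrite !big_cat !big_map /= colsE picks_map !big_map.
have row i : i \in iota 0 r ->
    opt1 (row_term t r cols i) = (if has (adj (nth x0 bs i)) es' then 1 else 2) *
      (n`!%:R * pt adj 2 0 B ([set x in bs ++ es'] :\ nth x0 bs i)) /\
    opt2 (row_term t r cols i) = (if has (adj (nth x0 bs i)) es' then 1 else 0) *
      (n`!%:R * pt adj 0 2 B ([set x in bs ++ es'] :\ nth x0 bs i)).
  move=> ir; have := okr i ir; rewrite mem_iota add0n /= in ir.
  rewrite /row_term !to_nat_scale !bin_weightE /=.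
  have -> : row_isolated i cols = ~~ has (adj (nth x0 bs i)) es'.
    rewrite /row_isolated colsE has_map; congr (~~ _); apply: eq_has => e /=.
    by rewrite (nth_map x0) ?sbs.
  set b := nth x0 bs i.
  case Elook: (look _ _ _) => [w|] //= _.
  have bbs : b \in bs by rewrite mem_nth ?sbs.
  have pb : perm_eq (b :: (take i bs ++ drop i.+1 bs)) bs.
    rewrite -cat1s perm_catCA /= -(drop_nth x0) ?sbs // cat_take_drop //.
  have sb : size (take i bs ++ drop i.+1 bs) = r.-1.
    by move/perm_size: pb; rewrite /= sbs => <-.
  have := perm_uniq pb; rewrite ubs cons_uniq => /andP[bnin ub].
  have sub x : x \in take i bs ++ drop i.+1 bs -> x \in bs.
    by move=> xs; rewrite -(perm_mem pb) inE xs orbT.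
  have sz' : all (fun c => size c == r.-1) (sort lexb [seq del_row i c | c <- cols]).
    apply/allP=> c; rewrite mem_sort => /mapP[c' c's ->].
    by rewrite (size_del_row ir) ?(eqP (allP szc c' c's)).
  have [||] := trie_inv_get inv Elook _ _ sz' erefl E adj B
    (take i bs ++ drop i.+1 bs) es' adjC bip ub ues' _ esB' sb.
  - by move=> x /sub; apply: bsB.
  - rewrite perm_sym perm_sort colsE /code -map_comp.
    by rewrite (@eq_map _ _ _ (fun e => [seq adj b e | b <- take i bs ++ drop i.+1 bs])) // => e /=;
       rewrite /del_row map_cat map_take map_drop.
  have -> : (size (take i bs ++ drop i.+1 bs) + size es')%N = n.
    by move: szn; rewrite sb sbs; case: (r) ir => //= r' _; rewrite addSn => -[].
  have -> : [set x in (take i bs ++ drop i.+1 bs) ++ es'] = [set x in bs ++ es'] :\ b.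
    apply/setP=> x; rewrite !inE !mem_cat -(perm_mem pb) inE mem_cat.
    case: (eqVneq x b) => //= ->; rewrite -mem_cat (negbTE bnin) /=.
    by apply/negP=> /esB'; rewrite bsB.
  by move=> -> ->; split; case: (has _ _).
have col p : p \in picks es' ->
    opt1 (col_term t r ([seq adj b p.1 | b <- bs], code adj bs p.2)) =
      (if has (adj p.1) bs then 1 else 0) *
      (n`!%:R * pt adj 2 0 B ([set x in bs ++ es'] :\ p.1)) /\
    opt2 (col_term t r ([seq adj b p.1 | b <- bs], code adj bs p.2)) =
      (if has (adj p.1) bs then 1 else 2) *
      (n`!%:R * pt adj 0 2 B ([set x in bs ++ es'] :\ p.1)).
  move=> pes; have := okc ([seq adj b p.1 | b <- bs], code adj bs p.2).
  rewrite colsE picks_map => /(_ (map_f _ pes)).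
  rewrite /col_term !to_nat_scale !bin_weightE /=.
  have -> : col_isolated [seq adj b p.1 | b <- bs] = ~~ has (adj p.1) bs.
    by rewrite /col_isolated has_map; congr (~~ _); apply: eq_has => b /=; rewrite adjC.
  case Elook: (look _ _ _) => [w|] //= _.
  have pp := picks_perm pes.
  have := perm_uniq pp; rewrite ues' cons_uniq => /andP[enin ue].
  have sub x : x \in p.2 -> x \in es'.
    by move=> xs; rewrite -(perm_mem pp) inE xs orbT.
  have sz' : all (fun c => size c == r) (code adj bs p.2).
    by apply/allP=> c /mapP[e _ ->]; rewrite size_map sbs.
  have [||] := trie_inv_get inv Elook _ _ sz' erefl E adj B bs p.2
    adjC bip ubs ue bsB _ sbs _ => //.
    by move=> x /sub; apply: esB'.
  have -> : (size bs + size p.2)%N = n.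
    by move: szn; rewrite -(perm_size pp) /= addnS => -[].
  have -> : [set x in bs ++ p.2] = [set x in bs ++ es'] :\ p.1.
    apply/setP=> x; rewrite !inE !mem_cat -(perm_mem pp) inE.
    case: (eqVneq x p.1) => //= ->; rewrite (negbTE enin) orbF.
    by apply/negP=> /bsB; rewrite (negbTE (esB' _ _)) // -(perm_mem pp) mem_head.
  by move=> -> ->; split; case: (has _ _).
split; congr (_ + _); apply: eq_big_seq => i ip.
- by rewrite -colsE; case: (row i ip) => ->.
- by case: (col i ip) => ->.
- by rewrite -colsE; case: (row i ip) => _ ->.
by case: (col i ip) => _ ->.
Qed.

Lemma size_bits r s : (s \in bits r) = (size s == r).
Proof.
elim: r s => [|r IHr] s; first by rewrite inE; case: s.
rewrite mem_cat; case: s => [|b s].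
  by apply/negbTE; rewrite negb_or; apply/andP; split; apply/mapP=> -[].
rewrite eqSS -IHr; apply/orP/idP => [[] /mapP[s' s'r [_ ->]] //|sr].
by case: b; [right|left]; rewrite map_f.
Qed.

Lemma multisets_cons (T : Type) (t : T) ts m : multisets (t :: ts) m =
  flatten [seq [seq nseq k t ++ s | s <- multisets ts (m - k)] | k <- iota 0 m.+1].
Proof. by []. Qed.

Lemma multisets_sub (T : eqType) (ts s : seq T) m :
  s \in multisets ts m -> {subset s <= ts}.
Proof.
elim: ts m s => [|t ts IHts] m s; first by case: m => //; rewrite inE => /eqP->.
rewrite multisets_cons => /flatten_mapP[k _ /mapP[s' s'm ->]] x.
rewrite mem_cat inE => /orP[|xs].
  by rewrite mem_nseq => /andP[_ ->].
by rewrite (IHts _ _ s'm) ?orbT.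
Qed.

Lemma multisets_complete (T : eqType) (ts s : seq T) : {subset s <= ts} ->
  exists2 s', perm_eq s s' & s' \in multisets ts (size s).
Proof.
elim: ts s => [|t ts IHts] s sub.
  by exists [::]; case: s sub => // x s /(_ x (mem_head _ _)).
have [|s' ps s'in] := IHts [seq x <- s | x != t].
  move=> x; rewrite mem_filter => /andP[xt /sub].
  by rewrite inE (negbTE xt).
have sE : perm_eq s (filter (pred1 t) s ++ filter (predC (pred1 t)) s).
  by rewrite perm_sym perm_filterC.
have fE : filter (pred1 t) s = nseq (count_mem t s) t.
  have /all_pred1P -> : all (pred1 t) (filter (pred1 t) s) by apply: filter_all.
  by rewrite size_filter.
exists (nseq (count_mem t s) t ++ s').
  by apply: perm_trans sE _; rewrite fE perm_cat2l.
rewrite multisets_cons; apply/flatten_mapP; exists (count_mem t s).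
  by rewrite mem_iota add0n ltnS count_size.
apply: map_f; move: s'in; rewrite size_filter -(count_predC (pred1 t) s) addKn.
by [].
Qed.

Lemma extend_sound t rc : all (fun c => size c == rc.1) rc.2 ->
  trie_inv t sound_entry -> trie_inv (extend t rc) sound_entry.
Proof.
move=> szc inv; rewrite /extend; case E1: (compute _ _ _) => [v|] //.
apply: trie_inv_put => // r cols sz eqk.
have [-> ->] := key_inj sz szc eqk.
exact: compute_sound E1.
Qed.

Lemma fill_sound r ts t m : {subset ts <= bits r} -> trie_inv t sound_entry ->
  trie_inv (fill r ts t m) sound_entry.
Proof.
rewrite /fill => sub; have : all (fun cols => all (fun c => size c == r) cols) (multisets ts m).
  apply/allP=> cols /multisets_sub mc; apply/allP=> c /mc /sub.
  by rewrite size_bits.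
elim: (multisets ts m) t => //= cols l IHl t /andP[sz szl] inv.
by apply: IHl => //; apply: extend_sound.
Qed.

Lemma foldl_sound (A : Type) (f : trie -> A -> trie) l t :
    (forall t a, trie_inv t sound_entry -> trie_inv (f t a) sound_entry) ->
  trie_inv t sound_entry -> trie_inv (foldl f t l) sound_entry.
Proof. by move=> fs; elim: l t => //= a l IHl t inv; apply: IHl; apply: fs. Qed.

Lemma table_sound rs ms ms4 : trie_inv (table rs ms ms4) sound_entry.
Proof.
rewrite /table; cbv zeta; set t0 := foldl _ Leaf _.
have inv0 : trie_inv t0 sound_entry.
  apply: foldl_sound; last exact: I.
  move=> t r inv; apply: foldl_sound; last exact: inv.
  by move=> t' m; apply: fill_sound.
clearbody t0; apply: foldl_sound; last exact: inv0.
by move=> t m; apply: fill_sound => s; rewrite mem_filter => /andP[].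
Qed.

Lemma to_nat_fact n : N.to_nat (bin_fact n) = n`!%N.
Proof.
elim: n => [|n IHn] //; rewrite factS -IHn.
have -> : bin_fact n.+1 = N.mul (N.of_nat n.+1) (bin_fact n) by [].
by rewrite N2Nat.inj_mul Nat2N.id.
Qed.

(** Without isolated vertices all columns are nonzero, so up to order they are among the checked
    multisets, and the case of an isolated row is excluded. *)
Lemma check_lower (E : finType) (adj : rel E) t r m p q : symmetric adj ->
    trie_inv t sound_entry -> (0 < q)%N -> check t r m p q ->
  lower adj r m (p%:R / q%:R).
Proof.
move=> adjC inv q0 /allP chk B S bip fS cB cC.
pose bs := enum (S :&: B); pose es := enum (S :\: B).
have sbs : size bs = r by rewrite -cardE.
have ses : size es = m by rewrite -cardE.
have SE : [set x in bs ++ es] = S.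
  by apply/setP=> x; rewrite inE mem_cat !mem_enum -in_setU setID.
have bsB : {in bs, forall x, x \in B} by move=> x; rewrite mem_enum inE => /andP[].
have esB : {in es, forall x, x \notin B} by move=> x; rewrite mem_enum inE => /andP[].
have fullP v : v \in S -> exists2 w, w \in S & adj v w.
  move=> vS; have /set0Pn[w] := forall_inP fS v vS.
  by rewrite in_nbr => /andP[]; exists w.
have sub : {subset code adj bs es <= covering_bits r}.
  move=> c /mapP[e ein ->]; rewrite mem_filter size_bits size_map sbs eqxx andbT negbK.
  have [|b bS eb] := fullP e; first by move: ein; rewrite mem_enum inE => /andP[].
  rewrite has_map; apply/hasP; exists b; last by rewrite /= adjC.
  by rewrite mem_enum inE bS; move/bip: eb; rewrite (negbTE (esB e ein)); case: (b \in B).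
have [cols pc cin] := multisets_complete sub.
rewrite size_map ses in cin; have := chk cols cin.
have szc : all (fun c => size c == r) cols.
  by apply/allP=> c; rewrite -(perm_mem pc) => /sub; rewrite mem_filter size_bits => /andP[].
case/orP=> [/hasP[i]|].
  rewrite mem_iota add0n /= => ir /hasPn iso.
  have [x0 _] : exists x0 : E, true.
    by move: ir; rewrite -sbs; case: (bs) => // x l _; exists x.
  have bin : nth x0 bs i \in bs by rewrite mem_nth ?sbs.
  have [|e eS be] := fullP (nth x0 bs i); first by move: bin; rewrite mem_enum inE => /andP[].
  have ein : e \in es.
    by rewrite mem_enum inE eS; move/bip: be; rewrite (bsB _ bin); case: (e \in B).
  have := iso [seq adj b e | b <- bs]; rewrite -(perm_mem pc) => /(_ (map_f _ ein)).
  by rewrite (nth_map x0) ?sbs // be.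
case Elook: (look _ _ _) => [[x y]|] // /N.leb_le le.
have {}le : (p * ((r + m)`! * (r + m)`!) <= q * (N.to_nat x * N.to_nat y))%N.
  have : (N.to_nat (N.of_nat p * (bin_fact (r + m) * bin_fact (r + m))) <=
      N.to_nat (N.of_nat q * (x * y)))%coq_nat by lia.
  by rewrite !N2Nat.inj_mul !Nat2N.id !to_nat_fact !multE => /ssrnat.leP.
have [] := trie_inv_get inv Elook _ _ szc erefl E adj B bs es adjC bip
  (enum_uniq _) (enum_uniq _) bsB esB sbs pc.
rewrite sbs ses SE /= => xE yE.
have f0 : 0 < (r + m)`!%:R :> rat by rewrite ltr0n fact_gt0.
rewrite -(ler_nat rat) !natrM xE yE in le.
rewrite ler_pdivrMr ?ltr0n // /mw /alpha ptC.
rewrite -(ler_pM2r (mulr_gt0 f0 f0)); apply: le_trans le _.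
by rewrite le_eqVlt; apply/orP; left; apply/eqP; ring.
Qed.

(** For one row and up to five columns this is the exact value [4 * (2 ^ m - 1) / (m + 1) ^ 2] of
    the star. The entries 81/16, 27/8, 9/4, 3/2 at the longest sides are powers of 3/2, because a
    centre with one leaf requires [3 * c <= 2 * g]; 45/16 is 5/4 of 9/4, required by two leaves. *)
Definition bounds : seq (nat * nat * (nat * nat)) :=
  [:: (1, 1, (1, 1)); (1, 2, (4, 3)); (1, 3, (7, 4)); (1, 4, (12, 5));
      (1, 5, (31, 9)); (1, 6, (81, 16)); (1, 7, (81, 16));
      (2, 1, (1, 1)); (2, 2, (1, 1)); (2, 3, (4, 3)); (2, 4, (4, 3));
      (2, 5, (2, 1)); (2, 6, (45, 16)); (2, 7, (27, 8));
      (3, 1, (1, 1)); (3, 2, (1, 1)); (3, 3, (1, 1)); (3, 4, (4, 3));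
      (3, 5, (7, 4)); (3, 6, (9, 4)); (3, 7, (9, 4));
      (4, 1, (1, 1)); (4, 2, (1, 1)); (4, 3, (1, 1)); (4, 4, (1, 1));
      (4, 5, (4, 3)); (4, 6, (3, 2))]%N.

Definition check_bounds t :=
  all (fun b => (0 < b.2.2)%N && check t b.1.1 b.1.2 b.2.1 b.2.2) bounds.

Lemma bounds_check : check_bounds (table (iota 0 4) (iota 0 8) (iota 0 7)).
Proof. by vm_compute. Qed.

Lemma check_bounds_lower (E : finType) (adj : rel E) t r m p q : symmetric adj ->
    trie_inv t sound_entry -> check_bounds t -> (r, m, (p, q)) \in bounds ->
  lower adj r m (p%:R / q%:R).
Proof.
by move=> adjC inv /allP chk /chk /andP[q0 c]; apply: (check_lower adjC inv).
Qed.

(** * Bounds for graphs with a side of at most five vertices *)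

Section Bounds.

Variables (E : finType) (adj : rel E).
Hypothesis adjC : symmetric adj.
Local Notation lower := (lower adj).

Lemma bounds_lower r m p q : (r, m, (p, q)) \in bounds -> lower r m (p%:R / q%:R).
Proof. exact: (check_bounds_lower adjC (table_sound _ _ _) bounds_check). Qed.

Lemma lowerS0 r c : lower r.+1 0 c.
Proof. exact/lowerC/lower0S. Qed.

(** With [f = c] the term [k ^ 2 * c] cancels, and [(k + 1) ^ 2 - k ^ 2 = 2 * k + 1]. *)
Lemma star_okB (c : rat) k d g :
  (2 * k%:R + 1) * c <= 2 ^+ k * (1 + k%:R / (d + k)%:R) * g -> star_ok c k d c g.
Proof. by move=> le; left; lra. Qed.

Lemma star_okW (c : rat) k d g : 0 <= g ->
  (2 * k%:R + 1) * c <= 2 ^+ k * g -> star_ok c k d c g.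
Proof.
move=> g0 le; apply: star_okB; apply: le_trans le _.
by rewrite ler_wpM2r // ler_peMr ?exprn_ge0 // lerDl divr_ge0.
Qed.

Lemma star_okD (c : rat) k d s g : (0 < k)%N -> (d + k <= s)%N -> 0 <= g ->
  (2 * k%:R + 1) * c <= 2 ^+ k * (1 + k%:R / s%:R) * g -> star_ok c k d c g.
Proof.
move=> k0 ds g0 le; apply: star_okB; apply: le_trans le _.
have dk : (0 < d + k)%N by rewrite addn_gt0 k0 orbT.
rewrite ler_wpM2r // ler_wpM2l ?exprn_ge0 // lerD2l ler_wpM2l //.
by rewrite lef_pV2 ?posrE ?ltr0n ?(leq_trans dk ds) // ler_nat.
Qed.

(** Each further leaf adds [2 * c] on the left and doubles the right; [2 * c <= 2 ^ k0] follows from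
    the starting inequality. *)
Lemma exp2_ge (c : rat) k0 k : (0 < k0)%N -> 0 <= c ->
  (2 * k0%:R + 1) * c <= 2 ^+ k0 -> (k0 <= k)%N -> (2 * k%:R + 1) * c <= 2 ^+ k.
Proof.
move=> k0pos c0 le0 /subnK <-.
have le1 : 2 * c <= 2 ^+ k0.
  apply: le_trans le0; rewrite ler_wpM2r //.
  have : 1 <= k0%:R :> rat by rewrite ler1n.
  lra.
elim: (k - k0)%N => // j IHj.
rewrite addSn exprS -natr1; set u := 2 ^+ (j + k0) in IHj *.
have : 2 ^+ k0 <= u by rewrite ler_weXn2l // leq_addl.
lra.
Qed.

Lemma star_ok1 (c : rat) k0 k d : (0 < k0)%N -> 0 <= c ->
  (2 * k0%:R + 1) * c <= 2 ^+ k0 -> (k0 <= k)%N -> star_ok c k d c 1.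
Proof.
move=> k0pos c0 le0 le; apply: star_okW => //.
by rewrite mulr1; apply: exp2_ge le.
Qed.

(** Induction on [m] with one constant: it also bounds the graph without a leaf, so only the bound
    [g] without the star is left to supply. *)
Lemma ladder_const r m0 (c : rat) : 0 <= c ->
    lower r.+1 m0 c ->
    (forall m, (m0 <= m)%N -> lower r m c) ->
    (forall m k d, (m0 <= m)%N -> (0 < k <= m.+1)%N -> (d <= m.+1 - k)%N ->
      exists2 g, lower r (m.+1 - k) g & star_ok c k d c g) ->
    (forall m k d, (m0 <= m)%N -> (0 < k <= r.+1)%N -> (d <= r.+1 - k)%N -> (1 < k + d)%N ->
      exists2 g, lower (r.+1 - k) m g & star_ok c k d c g) ->
  forall m, (m0 <= m)%N -> lower r.+1 m c.
Proof.
move=> c0 base low starB starC m /subnK <-; elim: (m - m0)%N => // j IHj.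
rewrite addSn; have le : (m0 <= j + m0)%N by rewrite leq_addl.
apply: (lower_ladder adjC c0) => //; try exact: low; try exact: leqW.
- by apply: low; exact: leqW.
- by move=> k d k1 d1 _; have [g lg ok] := starB _ _ _ le k1 d1; exists c, g.
move=> k d k1 d1 kd; have [g lg ok] := starC _ _ _ le k1 d1 kd; exists c, g; split=> //.
by apply: low; exact: leqW.
Qed.

Definition lower_from r m0 c := forall m, (m0 <= m)%N -> lower r m c.

Lemma lower0_from c : lower_from 0 1 c.
Proof. by case=> // m _; apply: lower0S. Qed.

(** When a star uses up one side but not the other, the remaining graph would have isolated
    vertices; every [g] is then a bound, in particular a large enough one. *)
Lemma star_void m (c : rat) k d : 0 <= c -> (0 < m)%N ->
  exists2 g, lower 0 m g & star_ok c k d c g.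
Proof.
move=> c0 m0; exists ((2 * k%:R + 1) * c); first exact: lower0_from.
have z0 : 0 <= (2 * k%:R + 1) * c by rewrite mulr_ge0 // addr_ge0 ?mulr_ge0.
by apply: star_okW => //; rewrite ler_peMl // exprn_ege1.
Qed.

Lemma lower_from_step r m0 c c' : lower r m0 c -> lower_from r m0.+1 c' -> c <= c' ->
  lower_from r m0 c.
Proof.
move=> l0 l1 cc m; rewrite leq_eqVlt => /predU1P[<- //|lt].
exact: lowerW cc (l1 m lt).
Qed.

Lemma star_all (c : rat) k : (2 * k%:R + 3) * c <= 2 ^+ k.+1 * 2 -> star_ok c k.+1 0 c 1.
Proof.
move=> le; apply: star_okB; rewrite add0n mulr1 divff ?pnatr_eq0 //.
by move: le; rewrite -(natr1 k); move: (2 ^+ _) => u; lra.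
Qed.

Lemma lower1_6 : lower_from 1 6 (81 / 16).
Proof.
have c0 : 0 <= 81 / 16 :> rat by lra.
apply: lower_from_step (@bounds_lower 1 6 81 16 isT) _ (lexx _).
apply: (@ladder_const 0 7 (81 / 16) c0 (@bounds_lower 1 7 81 16 isT)).
- by move=> m m7; apply: lower0_from; apply: leq_trans m7.
- move=> m k d m7 /andP[k0 km] dm.
  case E1: (m.+1 - k)%N => [|j]; last exact: star_void c0 _.
  have -> : k = m.+1 by lia.
  have -> : d = 0%N by lia.
  exists 1; first exact: lower00.
  apply: star_all.
  (* The whole other side consists of leaves, so [1 + k / (d + k)] equals 2. Halving [c] accounts
     for it, and [17 * 81/32 <= 2 ^ 8] is the start at [k = 8]. *)
  have := @exp2_ge (81 / 16 / 2) 8 m.+1 isT ltac:(lra) ltac:(rewrite !exprS expr0; lra) m7.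
  by rewrite -(natr1 m); move: (2 ^+ _) => u; lra.
by move=> m k d m7 k1 d1 kd; lia.
Qed.

Lemma lower1_5 : lower_from 1 5 (31 / 9).
Proof. by apply: lower_from_step (@bounds_lower 1 5 31 9 isT) lower1_6 _; lra. Qed.

Lemma lower1_4 : lower_from 1 4 (12 / 5).
Proof. by apply: lower_from_step (@bounds_lower 1 4 12 5 isT) lower1_5 _; lra. Qed.

Lemma lower1_3 : lower_from 1 3 (7 / 4).
Proof. by apply: lower_from_step (@bounds_lower 1 3 7 4 isT) lower1_4 _; lra. Qed.

Lemma lower1_2 : lower_from 1 2 (4 / 3).
Proof. by apply: lower_from_step (@bounds_lower 1 2 4 3 isT) lower1_3 _; lra. Qed.

Lemma lower1_1 : lower_from 1 1 (1 / 1).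
Proof. by apply: lower_from_step (@bounds_lower 1 1 1 1 isT) lower1_2 _; lra. Qed.

Lemma lower1_0 : lower_from 1 0 1.
Proof. by apply: lower_from_step (@lowerS0 0 1) lower1_1 _; lra. Qed.

Lemma lower2_7 : lower_from 2 7 (27 / 8).
Proof.
have c0 : 0 <= 27 / 8 :> rat by lra.
apply: (@ladder_const 1 7 (27 / 8) c0 (@bounds_lower 2 7 27 8 isT)).
- move=> m m7; apply: lowerW (lower1_6 _); first lra.
  exact: leq_trans m7.
- move=> m k d m7 /andP[k0 km] dm.
  case: k k0 km dm => [//|[|[|[|[|[|k]]]]]] _ km dm.
  + exists (81 / 16); first by apply: lower1_6; lia.
    by apply: star_okW; rewrite ?exprS ?expr0; lra.
  + exists (81 / 16); first by apply: lower1_6; lia.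
    by apply: star_okW; rewrite ?exprS ?expr0; lra.
  + exists (31 / 9); first by apply: lower1_5; lia.
    by apply: star_okW; rewrite ?exprS ?expr0; lra.
  + exists (12 / 5); first by apply: lower1_4; lia.
    by apply: star_okW; rewrite ?exprS ?expr0; lra.
  + exists (7 / 4); first by apply: lower1_3; lia.
    by apply: star_okW; rewrite ?exprS ?expr0; lra.
  exists 1; first exact: lower1_0.
  by apply: (@star_ok1 _ 6); rewrite // ?exprS ?expr0; lra.
move=> m k d m7 /andP[k0 km] dm kd.
case: k k0 km dm kd => [//|[|[|//]]] _ km dm kd; last first.
  by apply: star_void c0 _; lia.
exists (81 / 16); first by apply: lower1_6; lia.
by apply: star_okW; rewrite ?exprS ?expr0; lra.
Qed.

Lemma lower2_6 : lower_from 2 6 (45 / 16).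
Proof. by apply: lower_from_step (@bounds_lower 2 6 45 16 isT) lower2_7 _; lra. Qed.

Lemma lower2_5 : lower_from 2 5 (2 / 1).
Proof. by apply: lower_from_step (@bounds_lower 2 5 2 1 isT) lower2_6 _; lra. Qed.

Lemma lower2_4 : lower_from 2 4 (4 / 3).
Proof. by apply: lower_from_step (@bounds_lower 2 4 4 3 isT) lower2_5 _; lra. Qed.

Lemma lower2_3 : lower_from 2 3 (4 / 3).
Proof. by apply: lower_from_step (@bounds_lower 2 3 4 3 isT) lower2_4 _; lra. Qed.

Lemma lower2_2 : lower_from 2 2 (1 / 1).
Proof. by apply: lower_from_step (@bounds_lower 2 2 1 1 isT) lower2_3 _; lra. Qed.

Lemma lower2_1 : lower_from 2 1 (1 / 1).
Proof. by apply: lower_from_step (@bounds_lower 2 1 1 1 isT) lower2_2 _; lra. Qed.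

Lemma lower2_0 : lower_from 2 0 1.
Proof. by apply: lower_from_step (@lowerS0 1 1) lower2_1 _; lra. Qed.

Lemma lower3_6 : lower_from 3 6 (9 / 4).
Proof.
have c0 : 0 <= 9 / 4 :> rat by lra.
apply: lower_from_step (@bounds_lower 3 6 9 4 isT) _ (lexx _).
apply: (@ladder_const 2 7 (9 / 4) c0 (@bounds_lower 3 7 9 4 isT)).
- move=> m m7; apply: lowerW (lower2_7 m7); lra.
- move=> m k d m7 /andP[k0 km] dm.
  case: k k0 km dm => [//|[|[|[|[|k]]]]] _ km dm.
  + exists (27 / 8); first by apply: lower2_7; lia.
    by apply: star_okW; rewrite ?exprS ?expr0; lra.
  + exists (45 / 16); first by apply: lower2_6; lia.
    by apply: star_okW; rewrite ?exprS ?expr0; lra.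
  + exists (2 / 1); first by apply: lower2_5; lia.
    by apply: star_okW; rewrite ?exprS ?expr0; lra.
  + exists (4 / 3); first by apply: lower2_4; lia.
    by apply: star_okW; rewrite ?exprS ?expr0; lra.
  exists 1; first exact: lower2_0.
  by apply: (@star_ok1 _ 5); rewrite // ?exprS ?expr0; lra.
move=> m k d m7 /andP[k0 km] dm kd.
case: k k0 km dm kd => [//|[|[|[|//]]]] _ km dm kd; last first.
- by apply: star_void c0 _; lia.
- exists (81 / 16); first by apply: lower1_6; lia.
  by apply: star_okW; rewrite ?exprS ?expr0; lra.
exists (27 / 8); first by apply: lower2_7; lia.
by apply: star_okW; rewrite ?exprS ?expr0; lra.
Qed.

Lemma lower3_5 : lower_from 3 5 (7 / 4).
Proof. by apply: lower_from_step (@bounds_lower 3 5 7 4 isT) lower3_6 _; lra. Qed.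

Lemma lower3_4 : lower_from 3 4 (4 / 3).
Proof. by apply: lower_from_step (@bounds_lower 3 4 4 3 isT) lower3_5 _; lra. Qed.

Lemma lower3_3 : lower_from 3 3 (1 / 1).
Proof. by apply: lower_from_step (@bounds_lower 3 3 1 1 isT) lower3_4 _; lra. Qed.

Lemma lower3_2 : lower_from 3 2 (1 / 1).
Proof. by apply: lower_from_step (@bounds_lower 3 2 1 1 isT) lower3_3 _; lra. Qed.

Lemma lower3_1 : lower_from 3 1 (1 / 1).
Proof. by apply: lower_from_step (@bounds_lower 3 1 1 1 isT) lower3_2 _; lra. Qed.

Lemma lower3_0 : lower_from 3 0 1.
Proof. by apply: lower_from_step (@lowerS0 2 1) lower3_1 _; lra. Qed.

Lemma lower4_6 : lower_from 4 6 (3 / 2).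
Proof.
have c0 : 0 <= 3 / 2 :> rat by lra.
apply: (@ladder_const 3 6 (3 / 2) c0 (@bounds_lower 4 6 3 2 isT)).
- move=> m m6; apply: lowerW (lower3_6 m6); lra.
- move=> m k d m6 /andP[k0 km] dm.
  case: k k0 km dm => [//|[|[|[|k]]]] _ km dm.
  + exists (9 / 4); first by apply: lower3_6; lia.
    by apply: star_okW; rewrite ?exprS ?expr0; lra.
  + have [m7|m7] := ltnP 6 m.
      exists (9 / 4); first by apply: lower3_6; lia.
      by apply: star_okW; rewrite ?exprS ?expr0; lra.
    exists (7 / 4); first by apply: lower3_5; lia.
    (* Here [m = 6]: [4 * 7/4 = 7] misses [5 * 3/2], but the centre has degree at most 7, and the
       factor [1 + 2/7] raises 7 to 9. *)
    apply: (@star_okD _ 2 d 7); [by []|lia|lra|].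
    by rewrite ?exprS ?expr0; lra.
  + exists (4 / 3); first by apply: lower3_4; lia.
    by apply: star_okW; rewrite ?exprS ?expr0; lra.
  exists 1; first exact: lower3_0.
  by apply: (@star_ok1 _ 4); rewrite // ?exprS ?expr0; lra.
move=> m k d m6 /andP[k0 km] dm kd.
case: k k0 km dm kd => [//|[|[|[|[|//]]]]] _ km dm kd; last first.
- by apply: star_void c0 _; lia.
- exists (81 / 16); first by apply: lower1_6; lia.
  by apply: star_okW; rewrite ?exprS ?expr0; lra.
- exists (45 / 16); first by apply: lower2_6; lia.
  by apply: star_okW; rewrite ?exprS ?expr0; lra.
exists (9 / 4); first by apply: lower3_6; lia.
by apply: star_okW; rewrite ?exprS ?expr0; lra.
Qed.

Lemma lower4_5 : lower_from 4 5 (4 / 3).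
Proof. by apply: lower_from_step (@bounds_lower 4 5 4 3 isT) lower4_6 _; lra. Qed.

Lemma lower4_4 : lower_from 4 4 (1 / 1).
Proof. by apply: lower_from_step (@bounds_lower 4 4 1 1 isT) lower4_5 _; lra. Qed.

Lemma lower4_3 : lower_from 4 3 (1 / 1).
Proof. by apply: lower_from_step (@bounds_lower 4 3 1 1 isT) lower4_4 _; lra. Qed.

Lemma lower4_2 : lower_from 4 2 (1 / 1).
Proof. by apply: lower_from_step (@bounds_lower 4 2 1 1 isT) lower4_3 _; lra. Qed.

Lemma lower4_1 : lower_from 4 1 (1 / 1).
Proof. by apply: lower_from_step (@bounds_lower 4 1 1 1 isT) lower4_2 _; lra. Qed.

Lemma lower4_0 : lower_from 4 0 1.
Proof. by apply: lower_from_step (@lowerS0 3 1) lower4_1 _; lra. Qed.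

(** Up to four vertices on the other side the earlier bounds apply by symmetry. Beyond that, three
    or more leaves need only [g = 1]; one or two leaves are the delicate cases. *)
Lemma lower5_0 : lower_from 5 0 1.
Proof.
have c0 : 0 <= 1 :> rat by lra.
elim=> [_|m IHm _]; first exact: lowerS0.
have [m4|m4] := ltnP m 4.
  apply: lowerC => //.
  by case: m m4 {IHm} => [|[|[|[|//]]]] _; [apply: lower1_0|apply: lower2_0|
    apply: lower3_0|apply: lower4_0].
apply: (lower_ladder adjC c0); [exact: lower4_0|exact: IHm|exact: lower4_0| |].
- move=> k d /andP[k0 km] dm kd.
  case: k k0 km dm kd => [//|[|[|k]]] _ km dm kd.
  + have [m5|m5] := ltnP m 5.
      have mE : m = 4%N by lia.
      (* Five against five: without the leaf the bound is 4/3, exactly what [4 * c <= 3 * f]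
         needs. *)
      exists (4 / 3), 1; split; last by right; split=> //; lra.
        by rewrite mE; apply: lowerC => //; apply: lower4_5.
      exact: lower4_0.
    exists 1; have [m6|m6] := ltnP m 6; last first.
      exists (3 / 2); split; [exact: IHm|by apply: lower4_6; lia|].
      by apply: star_okW; rewrite ?exprS ?expr0; lra.
    exists (4 / 3); split; [exact: IHm|by apply: lower4_5; lia|].
    (* For [m = 5], [2 * 4/3] is less than 3, but degree at most 6 gives
       [2 * (1 + 1/6) * 4/3 = 28/9]. *)
    apply: (@star_okD _ 1 d 6); [by []|lia|lra|].
    by rewrite ?exprS ?expr0; lra.
  + exists 1; have [m7|m7] := ltnP m 7; last first.
      exists (3 / 2); split; [exact: IHm|by apply: lower4_6; lia|].
      by apply: star_okW; rewrite ?exprS ?expr0; lra.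
    exists 1; split; [exact: IHm|exact: lower4_0|].
    (* For [m <= 6] the degree is at most 7, and [4 * (1 + 2/7) = 36/7] exceeds 5. *)
    apply: (@star_okD _ 2 d 7); [by []|lia|lra|].
    by rewrite ?exprS ?expr0; lra.
  exists 1, 1; split; [exact: IHm|exact: lower4_0|].
  by apply: (@star_ok1 _ 3); rewrite // ?exprS ?expr0; lra.
move=> k d /andP[k0 km] dm kd.
have low4 : lower 4 m.+1 (4 / 3) by apply: lower4_5; lia.
have low4' : lower 4 m.+1 1 by apply: lower4_0.
case: k k0 km dm kd => [//|[|[|k]]] _ km dm kd.
(* A leaf among the five is removed, leaving four against at least five with bound 4/3, again
   exactly enough. *)
- exists (4 / 3), 1; split; [by []|exact: lower4_0|].
  by right; split=> //; lra.
- exists 1, 1; split; [by []|exact: lower3_0|].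
  apply: (@star_okD _ 2 d 5); [by []|lia|lra|].
  by rewrite ?exprS ?expr0; lra.
exists 1; have [m0|m0] := posnP (5 - k.+3)%N.
  have [g lg ok] := @star_void m 1 k.+3 d c0 ltac:(lia).
  by exists g; split=> //; rewrite m0.
exists 1; split=> //.
  have : (5 - k.+3 < 3)%N by lia.
  by case: (5 - k.+3)%N m0 => [//|[|[|//]]] _ _; [apply: lower1_0|apply: lower2_0].
by apply: (@star_ok1 _ 3); rewrite // ?exprS ?expr0; lra.
Qed.

Lemma lower_le5 r m : (r <= 5)%N || (m <= 5)%N -> lower r m 1.
Proof.
suff low r' m' : (r' <= 5)%N -> lower r' m' 1.
  by case/orP=> le; [|apply: lowerC => //]; apply: low.
case: r' => [|[|[|[|[|[|//]]]]]] _; last 5 first.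
- exact: lower1_0.
- exact: lower2_0.
- exact: lower3_0.
- exact: lower4_0.
- exact: lower5_0.
by case: m' => [|m']; [exact: lower00|exact: lower0S].
Qed.

End Bounds.

(** * Deletion and contraction *)

Section Rank.

Variables (E : finType) (N : matroid E).
Implicit Types (A B G I J : {set E}) (e f : E).

Lemma rank_ge A I : I \subset A -> indep N I -> (#|I| <= rank N A)%N.
Proof. by move=> IA indI; apply: leq_bigmax_cond; rewrite IA. Qed.

Lemma rank_ex A : exists I, [/\ I \subset A, indep N I & #|I| = rank N A].
Proof.
have [|I /andP[IA indI] eqI] :=
    @eq_bigmax_cond _ [pred I : {set E} | (I \subset A) && indep N I] (fun I : {set E} => #|I|).
  by apply/card_gt0P; exists set0; rewrite !inE sub0set indep0.
by exists I; split=> //; rewrite -eqI; apply: eq_bigl.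
Qed.

Lemma rank_le_card A : (rank N A <= #|A|)%N.
Proof. by have [I [IA _ <-]] := rank_ex A; exact: subset_leq_card. Qed.

Lemma rankS A A' : A \subset A' -> (rank N A <= rank N A')%N.
Proof.
by move=> AA; have [I [IA indI <-]] := rank_ex A; apply: rank_ge (subset_trans IA AA) indI.
Qed.

Lemma indep_basis I : indep N I -> exists2 B, basis N B & I \subset B.
Proof. by case/maxset_exists=> B; exists B. Qed.

Lemma basisI B I : basis N B -> indep N I ->
  exists K, [/\ basis N K, I \subset K & K \subset I :|: B].
Proof.
move=> bB indI; have leIB := indep_card_basis bB indI.
have [K [indK IK KU cK]] := indep_augment indI (basis_indep bB) leIB.
by exists K; split=> //; apply: basis_card bB _ _.
Qed.

Lemma basis_eq_card B B' : basis N B -> basis N B' -> #|B| = #|B'|.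
Proof.
move=> bB bB'; apply/eqP.
by rewrite eqn_leq (indep_card_basis bB') ?(indep_card_basis bB) ?basis_indep.
Qed.

(** Minors keep the type [E]; a set [G] containing all independent sets serves as their ground
    set. *)
Definition supported G := forall A, indep N A -> A \subset G.

Lemma rank_basis G B : supported G -> basis N B -> rank N G = #|B|.
Proof.
move=> onG bB; apply/eqP; rewrite eqn_leq rank_ge ?onG ?basis_indep // andbT.
by have [I [_ indI <-]] := rank_ex G; apply: indep_card_basis bB indI.
Qed.

Definition is_coloop e := [forall B, basis N B ==> (e \in B)].

Lemma coloopPn e : reflect (exists2 B, basis N B & e \notin B) (~~ is_coloop e).
Proof.
rewrite negb_forall; apply: (iffP existsP) => [[B]|[B bB eB]].
  by rewrite negb_imply => /andP[]; exists B.
by exists B; rewrite negb_imply bB.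
Qed.

Lemma loop_notin e B : ~~ indep N [set e] -> indep N B -> e \notin B.
Proof.
by move=> le indB; apply: contra le => eB; apply: indepS indB; rewrite sub1set.
Qed.

Lemma coloop_indep e I : is_coloop e -> indep N I -> indep N (e |: I).
Proof.
move=> /forallP ce /indep_basis[B bB IB].
apply: (@indepS _ _ _ B); last exact: basis_indep.
by rewrite subUset sub1set IB (implyP (ce B)).
Qed.

Definition del_indep e : pred {set E} := fun A => (e \notin A) && indep N A.

Lemma del_indep0 e : del_indep e set0.
Proof. by rewrite /del_indep inE indep0. Qed.

Lemma del_indepS e I J : I \subset J -> del_indep e J -> del_indep e I.
Proof.
move=> IJ /andP[eJ indJ]; apply/andP; split; last exact: indepS indJ.
by apply: contra eJ; apply: (subsetP IJ).
Qed.

Lemma del_indepX e I J : del_indep e I -> del_indep e J -> (#|I| < #|J|)%N ->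
  exists2 x, x \in J :\: I & del_indep e (x |: I).
Proof.
move=> /andP[eI indI] /andP[eJ indJ] lt.
have [x xJI indx] := indepX indI indJ lt; exists x => //.
rewrite /del_indep indx andbT !inE negb_or eI andbT.
by apply: contraNneq eJ => ->; move: xJI; rewrite inE => /andP[].
Qed.

Definition del e := Matroid (@del_indep0 e) (@del_indepS e) (@del_indepX e).

(* Contracting a loop means deleting it. *)
Definition con_base e : {set E} := if indep N [set e] then [set e] else set0.

Definition con_indep e : pred {set E} :=
  fun A => (e \notin A) && indep N (con_base e :|: A).

Lemma con_base_sub e : con_base e \subset [set e].
Proof. by rewrite /con_base; case: ifP; rewrite ?sub0set. Qed.

Lemma con_indep0 e : con_indep e set0.
Proof.
by rewrite /con_indep inE setU0 /con_base; case: ifP => //; rewrite indep0.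
Qed.

Lemma con_indepS e I J : I \subset J -> con_indep e J -> con_indep e I.
Proof.
move=> IJ /andP[eJ indJ]; apply/andP; split.
  by apply: contra eJ; apply: (subsetP IJ).
by apply: indepS indJ; apply: setUS.
Qed.

Lemma card_con e I : e \notin I -> #|con_base e :|: I| = (#|con_base e| + #|I|)%N.
Proof.
move=> eI; apply/eqP; rewrite (leq_card_setU _ _).2.
by apply: disjointWl (con_base_sub e) _; rewrite disjoints1.
Qed.

Lemma con_indepX e I J : con_indep e I -> con_indep e J -> (#|I| < #|J|)%N ->
  exists2 x, x \in J :\: I & con_indep e (x |: I).
Proof.
move=> /andP[eI indI] /andP[eJ indJ] lt.
have [|x xJI indx] := indepX indI indJ; first by rewrite !card_con // ltn_add2l.
move: xJI; rewrite !inE negb_or => /andP[/andP[xb xI] /orP[xb'|xJ]].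
  by rewrite xb' in xb.
exists x; first by rewrite !inE xI.
rewrite /con_indep setUCA indx andbT !inE negb_or eI andbT.
by apply: contraNneq eJ => ->.
Qed.

Definition con e := Matroid (@con_indep0 e) (@con_indepS e) (@con_indepX e).

End Rank.

Section Minors.

Variables (E : finType) (N : matroid E).
Implicit Types (A B G I J : {set E}) (e f : E).

Lemma supported_del G e : supported N G -> supported (del N e) (G :\ e).
Proof. by move=> onG A /andP[eA indA]; rewrite subsetD1 onG. Qed.

Lemma supported_con G e : supported N G -> supported (con N e) (G :\ e).
Proof.
move=> onG A /andP[eA indA]; rewrite subsetD1 eA andbT.
by apply: subset_trans (onG _ indA); apply: subsetUr.
Qed.

Lemma con_indepE e A : indep N [set e] -> indep (con N e) A = (e \notin A) && indep N (e |: A).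
Proof. by move=> ie; rewrite /= /con_indep /con_base ie. Qed.

Lemma con_loop_indepE e A : ~~ indep N [set e] -> indep (con N e) A = indep N A.
Proof.
move=> ie; rewrite /= /con_indep /con_base (negbTE ie) set0U.
by case: (boolP (indep N A)) => [/(loop_notin ie)->|]; rewrite ?andbF.
Qed.

Lemma basis_del e B : ~~ is_coloop N e -> basis (del N e) B = (e \notin B) && basis N B.
Proof.
case/coloopPn=> B0 b0 eB0.
have c0 : basis (del N e) B0.
  apply/maxsetP; split=> [|B' /andP[_ indB'] sub]; first by rewrite /= /del_indep eB0 basis_indep.
  by case/maxsetP: b0 => _; apply.
apply/idP/andP=> [bB|[eB bB]].
  have /andP[eB indB] := basis_indep bB; split=> //.
  by apply: basis_card b0 indB _; apply: basis_eq_card bB c0.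
by apply: basis_card c0 _ (basis_eq_card bB b0); rewrite /= /del_indep eB basis_indep.
Qed.

Lemma basis_con e B : indep N [set e] ->
  basis (con N e) B = (e \notin B) && basis N (e |: B).
Proof.
move=> ie.
have [B0 b0 eB0] := indep_basis ie; rewrite sub1set in eB0.
have c0 : basis (con N e) (B0 :\ e).
  apply/maxsetP; split=> [|B']; rewrite con_indepE //.
    by rewrite !inE eqxx setD1K ?basis_indep.
  move=> /andP[eB' indB'] sub; rewrite -(setU1K eB'); congr (_ :\ _).
  case/maxsetP: b0 => _; apply=> //.
  by rewrite -(setD1K eB0) setUS.
have cE A : e \notin A -> #|e |: A| = #|A|.+1 by move=> eA; rewrite cardsU1 eA.
apply/idP/andP=> [bB|[eB bB]].
  have := basis_indep bB; rewrite con_indepE // => /andP[eB indB]; split=> //.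
  apply: basis_card b0 indB _.
  by rewrite cE // (basis_eq_card bB c0) (cardsD1 e B0) eB0.
apply: basis_card c0 _ _; first by rewrite con_indepE // eB basis_indep.
by move: (basis_eq_card bB b0); rewrite cE // (cardsD1 e B0) eB0 => -[].
Qed.

Lemma basis_con_loop e B : ~~ indep N [set e] -> basis (con N e) B = basis N B.
Proof. by move=> ie; apply: maxset_eq => A; apply: con_loop_indepE. Qed.

Lemma rank_del e A : e \notin A -> rank (del N e) A = rank N A.
Proof.
move=> eA; apply: eq_bigl => I /=; rewrite /del_indep.
case: (boolP (I \subset A)) => //= IA.
by rewrite (contra (subsetP IA e)).
Qed.

Lemma rank_con_loop e A : ~~ indep N [set e] -> rank (con N e) A = rank N A.
Proof. by move=> ie; apply: eq_bigl => I; rewrite con_loop_indepE. Qed.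

Lemma rankU1_loop e A : ~~ indep N [set e] -> rank N (e |: A) = rank N A.
Proof.
move=> ie; apply: eq_bigl => I; apply: andb_id2r => indI.
have eI := loop_notin ie indI.
by rewrite -subDset (setDidPl _) // disjoint_sym disjoints1.
Qed.

Lemma rank_con e A : indep N [set e] -> e \notin A ->
  rank N (e |: A) = (rank (con N e) A).+1.
Proof.
move=> ie eA; apply/eqP; rewrite eqn_leq; apply/andP; split.
  have [I [IA indI cI]] := rank_ex N (e |: A).
  have c1 : (#|[set e]| <= #|I|)%N by rewrite cI rank_ge // sub1set setU11.
  have [K [indK eK KI cK]] := indep_augment ie indI c1.
  rewrite sub1set in eK; rewrite -cI -cK (cardsD1 e) eK ltnS rank_ge //.
    by rewrite subDset; apply: subset_trans KI _; rewrite subUset sub1set setU11.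
  by rewrite con_indepE // !inE eqxx setD1K.
have [I [IA]] := rank_ex (con N e) A; rewrite con_indepE // => /andP[eI indI] <-.
by rewrite -[_.+1]/(true + _)%N -eI -cardsU1 rank_ge // setUS.
Qed.

Lemma rank_coloop e A : is_coloop N e -> e \notin A -> rank (con N e) A = rank N A.
Proof.
move=> ce eA; apply: eq_bigl => I; case: (boolP (I \subset A)) => //= IA.
have eI : e \notin I by apply: contra eA; apply: (subsetP IA).
have ie : indep N [set e] by rewrite -[[set e]]setU0; apply: coloop_indep; rewrite ?indep0.
rewrite /con_indep /con_base ie eI /=; apply/idP/idP; last exact: coloop_indep.
by apply: indepS; apply: subsetUr.
Qed.

End Minors.

(** * Tutte values as sums over bases *)

Section TutteExpansion.

Variables (E : finType) (x y : rat).
Implicit Types (N : matroid E) (A B G : {set E}) (e f u v : E).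

Definition tau N G : rat :=
  \sum_(A : {set E} | A \subset G)
    (x - 1) ^+ (rank N G - rank N A) * (y - 1) ^+ (#|A| - rank N A).

Lemma sum_setD1 (f : {set E} -> rat) G e : e \in G ->
  \sum_(A : {set E} | A \subset G) f A =
  \sum_(A : {set E} | A \subset G :\ e) f A +
  \sum_(A : {set E} | A \subset G :\ e) f (e |: A).
Proof.
move=> eG; rewrite (bigID (fun A : {set E} => e \notin A)) /=; congr (_ + _).
  by apply: eq_bigl => A; rewrite subsetD1.
rewrite (reindex_onto (fun A => e |: A) (fun A => A :\ e)) /=; last first.
  by move=> A /andP[_]; rewrite negbK => eA; rewrite setD1K.
apply: eq_bigl => A; rewrite subUset sub1set eG setU11 /= subsetD1.
have [eA|eA] := boolP (e \in A); last by rewrite setU1K // eqxx !andbT.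
by rewrite andbF; apply/andP=> -[_ /eqP/setP/(_ e)]; rewrite !inE eqxx eA.
Qed.

Lemma tau_loop N G e : e \in G -> ~~ indep N [set e] ->
  tau N G = y * tau (con N e) (G :\ e).
Proof.
move=> eG ie; rewrite /tau (sum_setD1 _ eG) mulr_sumr -big_split /=.
apply: eq_bigr => A; rewrite subsetD1 => /andP[AG eA].
have rG : rank N G = rank N (G :\ e) by rewrite -{1}(setD1K eG) rankU1_loop.
rewrite rG rankU1_loop // !rank_con_loop //.
rewrite cardsU1 eA subSn ?rank_le_card // exprS.
by rewrite mulrCA -[X in X + _]mul1r -mulrDl [1 + _]addrC subrK.
Qed.

Lemma tau_coloop N G e : e \in G -> is_coloop N e ->
  tau N G = x * tau (con N e) (G :\ e).
Proof.
move=> eG ce.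
have ie : indep N [set e] by rewrite -[[set e]]setU0; apply: coloop_indep; rewrite ?indep0.
rewrite /tau (sum_setD1 _ eG) mulr_sumr -big_split /=.
apply: eq_bigr => A; rewrite subsetD1 => /andP[AG eA].
have AG' : A \subset G :\ e by rewrite subsetD1 AG.
have rG : rank N G = (rank (con N e) (G :\ e)).+1.
  by rewrite -{1}(setD1K eG) rank_con // !inE eqxx.
rewrite rG rank_con // -(rank_coloop ce eA).
rewrite subSn ?rankS // cardsU1 eA !subSS exprS.
by rewrite -mulrA -[X in _ + X]mul1r -mulrDl subrK.
Qed.

Lemma tau_delcon N G e : supported N G -> e \in G -> indep N [set e] -> ~~ is_coloop N e ->
  tau N G = tau (del N e) (G :\ e) + tau (con N e) (G :\ e).
Proof.
move=> onG eG ie ce; rewrite /tau (sum_setD1 _ eG); congr (_ + _).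
  apply: eq_bigr => A; rewrite subsetD1 => /andP[AG eA].
  rewrite !rank_del ?inE ?eqxx //; suff -> : rank N G = rank N (G :\ e) by [].
  apply/eqP; rewrite eqn_leq [X in _ && X]rankS ?subD1set // andbT.
  have [B bB eB] := coloopPn _ _ ce.
  rewrite (rank_basis onG bB) rank_ge ?basis_indep // subsetD1 eB onG //.
  exact: basis_indep.
apply: eq_bigr => A; rewrite subsetD1 => /andP[AG eA].
have rG : rank N G = (rank (con N e) (G :\ e)).+1.
  by rewrite -{1}(setD1K eG) rank_con // !inE eqxx.
by rewrite rG rank_con // cardsU1 eA !subSS.
Qed.

(** As a symmetric difference this is symmetric in [u] and [v] and commutes with complementing [B],
    so a basis and its dual basis have the same exchange graph. *)
Definition swap B u v : {set E} := [set z | (z \in B) (+) (z \in [set u; v])].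

Definition exch N B : rel E :=
  fun u v => ((u \in B) != (v \in B)) && basis N (swap B u v).

Lemma exch_sym N B : symmetric (exch N B).
Proof. by move=> u v; rewrite /exch eq_sym /swap [[set u; v]]setUC. Qed.

Lemma exch_bipartite N B : bipartite (exch N B) B.
Proof. by move=> u v /andP[]. Qed.

Lemma swapE B u v : u \in B -> v \notin B -> swap B u v = v |: (B :\ u).
Proof.
move=> uB vB; apply/setP=> z; rewrite !inE.
case: (eqVneq z v) => [->|_]; first by rewrite (negbTE vB) orbT.
by rewrite orbF; case: (eqVneq z u) => [->|_]; rewrite ?uB //= addbF.
Qed.

Definition exch_sum N G : rat := \sum_(B | basis N B) pt (exch N B) x y B G.

(** Adding [e] turns the bases of the contraction into the bases through [e], and away from [e] the
    exchange graph stays the same. *)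
Lemma exch_sum_con N G e : indep N [set e] ->
  exch_sum (con N e) (G :\ e) =
  \sum_(B | basis N B && (e \in B)) pt (exch N B) x y B (G :\ e).
Proof.
move=> ie; rewrite [RHS](reindex_onto (fun B => e |: B) (fun B => B :\ e)) /=; last first.
  by move=> B /andP[_ eB]; rewrite setD1K.
apply: eq_big => [B|B bB].
  rewrite basis_con // setU11 andbT andbC; congr (_ && _).
  apply/idP/eqP=> [eB|<-]; [exact: setU1K|by rewrite !inE eqxx].
apply: eq_pt => [u v|u]; rewrite !inE => /andP[/negbTE ue _]; last by rewrite ue.
case/andP=> /negbTE ve _; rewrite /exch !inE ue ve /=; congr (_ && _).
rewrite basis_con // inE !inE ![e == _]eq_sym ue ve.
move: bB; rewrite basis_con // => /andP[/negbTE-> _] /=; congr (basis N _).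
apply/setP=> z; rewrite !inE; case: (eqVneq z e) => [->|//].
by rewrite ![e == _]eq_sym ue ve.
Qed.

Lemma exch_sum_del N G e : ~~ is_coloop N e ->
  exch_sum (del N e) (G :\ e) =
  \sum_(B | basis N B && (e \notin B)) pt (exch N B) x y B (G :\ e).
Proof.
move=> ce; apply: eq_big => [B|B]; first by rewrite basis_del // andbC.
rewrite basis_del // => /andP[/negbTE eB _].
apply: eq_pt => [u v|//]; rewrite !inE => /andP[/negbTE ue _] /andP[/negbTE ve _].
by rewrite /exch basis_del // !inE eB ![e == _]eq_sym ue ve.
Qed.

Lemma exch_sum_con_loop N G e : ~~ indep N [set e] ->
  exch_sum (con N e) G = exch_sum N G.
Proof.
move=> ie; apply: eq_big => [B|B _]; first exact: basis_con_loop.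
by apply: eq_pt => [u v _ _|//]; rewrite /exch basis_con_loop.
Qed.

Lemma nbr_loop N G B e : ~~ indep N [set e] -> basis N B -> nbr (exch N B) G e = set0.
Proof.
move=> ie bB; apply/setP=> v; rewrite !inE; apply/negbTE/and3P=> -[_ _ /basis_indep].
move/(loop_notin ie); rewrite !inE eqxx /= addbT negbK.
by apply/negP; apply: loop_notin ie (basis_indep bB).
Qed.

Lemma nbr_coloop N G B e : is_coloop N e -> basis N B -> nbr (exch N B) G e = set0.
Proof.
move=> /forallP ce bB; apply/setP=> v; rewrite !inE; apply/negbTE/and3P=> -[_ _ b].
by move: (implyP (ce _) b); rewrite !inE eqxx /= (implyP (ce _) bB).
Qed.

(** If [e] is in [B], then [B :\ e] is completed from a basis avoiding [e]; otherwise [[set e]] is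
    completed from [B]. Either way the new basis differs from [B] by one exchange. *)
Lemma nbr_exch_neq0 N G B e : supported N G -> indep N [set e] -> ~~ is_coloop N e ->
  basis N B -> nbr (exch N B) G e != set0.
Proof.
move=> onG ie ce bB; have BG := onG _ (basis_indep bB).
apply/set0Pn; have [eB|eB] := boolP (e \in B).
  have [B' bB' eB'] := coloopPn _ _ ce.
  have indD : indep N (B :\ e) by apply: indepS (basis_indep bB); apply: subD1set.
  have [K [bK DK KU]] := basisI bB' indD.
  have eK : e \notin K.
    by apply/negP=> /(subsetP KU); rewrite !inE eqxx (negbTE eB').
  have cK := basis_eq_card bK bB.
  have [v vK vB] : exists2 v, v \in K & v \notin B.
    apply/subsetPn; apply: contra eK => KB.
    have /eqP-> // : K == B by rewrite eqEcard KB cK leqnn.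
  exists v; rewrite in_nbr (subsetP (onG _ (basis_indep bK))) //=.
  rewrite /exch eB (negbTE vB) swapE //; suff -> : v |: B :\ e = K by [].
  apply/eqP; rewrite eqEcard subUset sub1set vK DK /=.
  by rewrite cardsU1 !inE (negbTE vB) andbF cK (cardsD1 e B) eB.
have [K [bK eK KU]] := basisI bB ie; rewrite sub1set in eK.
have cK := basis_eq_card bK bB.
have [b bB' bK'] : exists2 b, b \in B & b \notin K.
  apply/subsetPn; apply: contra eB => KB.
  have /eqP-> // : B == K by rewrite eqEcard KB cK leqnn.
exists b; rewrite in_nbr (subsetP BG) //= exch_sym.
rewrite /exch bB' (negbTE eB) swapE //; suff -> : e |: B :\ b = K by [].
apply/eqP; rewrite eq_sym eqEcard; apply/andP; split.
  apply/subsetP=> z zK; move: (subsetP KU z zK); rewrite !inE => /orP[->//|zB].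
  by rewrite zB andbT orbC; case: eqVneq zK bK' => // -> ->.
by rewrite cardsU1 !inE (negbTE eB) andbF cK (cardsD1 b B) bB'.
Qed.

(* Averaging the deletion-contraction rule over all elements of G gives the
   recursion that defines [pt]. *)
Lemma tau_exch_sum N G : supported N G -> tau N G = exch_sum N G.
Proof.
have [n] := ubnP #|G|; elim: n N G => // n IHn N G; rewrite ltnS => leG onG.
have [G0|/set0Pn[e0 e0G]] := eqVneq G set0.
  have iE A : indep N A = (A == set0).
    by apply/idP/eqP=> [/onG|->]; rewrite ?indep0 // G0 subset0 => /eqP.
  have r0 A : A \subset set0 -> rank N A = 0%N.
    by rewrite subset0 => /eqP->; apply/eqP; rewrite -leqn0 -(cards0 E) rank_le_card.
  rewrite /tau G0 (big_pred1 set0) => [|A]; last exact: subset0.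
  rewrite !r0 // cards0 mulr1 /exch_sum (big_pred1 set0) ?pt0 // => A /=.
  apply/maxsetP/eqP=> [[]|->]; first by rewrite iE => /eqP.
  by split=> [|B]; rewrite iE // => /eqP.
have cG : #|G|%:R != 0 :> rat by rewrite pnatr_eq0 -lt0n; apply/card_gt0P; exists e0.
apply: (mulfI cG); rewrite /exch_sum [RHS]mulr_sumr.
under eq_bigr do rewrite ptE.
rewrite exchange_big /=.
rewrite mulr_natl -sumr_const; apply: eq_bigr => e eG.
have leGe : (#|G :\ e| < n)%N by move: leG; rewrite (cardsD1 e) eG.
have IHc := IHn _ _ leGe (supported_con (e := e) onG).
have IHd := IHn _ _ leGe (supported_del (e := e) onG).
have [ie|ie] := boolP (indep N [set e]); last first.
  rewrite (tau_loop eG ie) IHc exch_sum_con_loop // mulr_sumr.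
  apply: eq_bigr => B bB; congr (_ * _).
  by rewrite /weight nbr_loop // eqxx (negbTE (loop_notin ie (basis_indep bB))).
have [ce|ce] := boolP (is_coloop N e).
  rewrite (tau_coloop eG ce) IHc exch_sum_con // mulr_sumr.
  have eB B : basis N B -> e \in B by apply: (implyP (forallP ce B)).
  apply: eq_big => [B|B /andP[bB eB']].
    by case: (boolP (basis N B)) => // /eB->.
  by rewrite /weight nbr_coloop // eqxx eB'.
rewrite (tau_delcon onG eG ie ce) IHc IHd exch_sum_con // exch_sum_del //.
rewrite [RHS](bigID (fun B : {set E} => e \in B)) /= addrC.
by congr (_ + _); apply: eq_bigr => B /andP[bB _];
   rewrite /weight (negbTE (nbr_exch_neq0 onG ie ce bB)) mul1r.
Qed.

End TutteExpansion.

(** * The inequality for paving matroids *)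

Section MerinoWelsh.

Variable E : finType.
Implicit Types (N : matroid E) (A B G : {set E}) (e f : E).

Definition merino_welsh N G := tau 1 1 N G ^+ 2 <= tau 2 0 N G * tau 0 2 N G.

Lemma tau_ge0 N G : supported N G -> [/\ 0 <= tau 2 0 N G, 0 <= tau 0 2 N G & 0 <= tau 1 1 N G].
Proof.
move=> onG; rewrite !tau_exch_sum //; split; apply: sumr_ge0 => B _.
- exact: alpha_ge0.
- by rewrite -(ptC _ 2 0); apply: alpha_ge0.
by rewrite pt11.
Qed.

(** Stated for small sets instead of circuits: contraction shifts size and rank together, so the
    condition passes directly to minors. *)
Definition paving4 N G :=
  forall A, A \subset G -> (#|A| + 4 <= rank N G)%N -> indep N A.

Definition loop_coloop_free N G :=
  forall e, e \in G -> indep N [set e] && ~~ is_coloop N e.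

Lemma merino_welsh_small N G B : supported N G -> loop_coloop_free N G -> basis N B ->
  (#|B| <= 5)%N || (#|G :\: B| <= 5)%N -> merino_welsh N G.
Proof.
move=> onG lcf bB small; rewrite /merino_welsh !tau_exch_sum // -[X in X <= _]mul1r.
apply: cauchy_sum => // [B' _|B' bB'].
  by rewrite pt11 -(ptC _ 2 0); split=> //; apply: alpha_ge0.
have B'G : B' \subset G by apply/onG/basis_indep.
have c1 := basis_eq_card bB' bB.
have BG : B \subset G by apply/onG/basis_indep.
have c2 : #|G :\: B'| = #|G :\: B| by rewrite !cardsDS // c1.
rewrite pt11 expr1n mulr1 -[X in _ * X](ptC _ 2 0).
apply: (lower_le5 (@exch_sym _ N B') small); last first.
- exact: c2.
- by rewrite (setIidPr B'G).
- apply/forall_inP=> e eG; have /andP[ie ce] := lcf e eG.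
  exact: nbr_exch_neq0.
exact: exch_bipartite.
Qed.

Definition parallel N e f := ~~ indep N [set e; f].

Definition series N e f := [forall B, basis N B ==> (e \in B) || (f \in B)].

Lemma seriesPn N e f :
  reflect (exists B, [/\ basis N B, e \notin B & f \notin B]) (~~ series N e f).
Proof.
rewrite negb_forall; apply: (iffP existsP) => -[B].
  by rewrite negb_imply negb_or => /and3P[]; exists B.
by case=> bB eB fB; exists B; rewrite negb_imply negb_or bB eB.
Qed.

(** Deletion creates no loops, and a coloop only from an element in series with [e]; [lcf_con] is
    the dual statement. *)
Lemma lcf_del N G e : loop_coloop_free N G -> e \in G ->
    {in G :\ e, forall f, ~~ series N e f} ->
  loop_coloop_free (del N e) (G :\ e).
Proof.
move=> lcf eG ns f fG; have := fG; rewrite inE => /andP[fe fG'].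
have /andP[_ ce] := lcf e eG; have /andP[If _] := lcf f fG'.
rewrite inE in fe.
rewrite /= /del_indep inE eq_sym fe If /=.
have /seriesPn[B [bB eB fB]] := ns f fG.
by apply/coloopPn; exists B; rewrite // basis_del // eB.
Qed.

Lemma lcf_con N G e : loop_coloop_free N G -> e \in G ->
    {in G :\ e, forall f, ~~ parallel N e f} ->
  loop_coloop_free (con N e) (G :\ e).
Proof.
move=> lcf eG np f fG; have := fG; rewrite !inE => /andP[fe fG'].
have /andP[ie _] := lcf e eG; have /andP[_ cf] := lcf f fG'.
have := np f fG; rewrite negbK => Ief.
rewrite con_indepE // inE eq_sym fe Ief /=.
have [B bB fB] := coloopPn _ _ cf.
have [K [bK eK KU]] := basisI bB ie; rewrite sub1set in eK.
apply/coloopPn; exists (K :\ e).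
  by rewrite basis_con // !inE eqxx setD1K.
rewrite inE negb_and; apply/orP; right.
by apply/negP=> /(subsetP KU); rewrite !inE (negbTE fe) (negbTE fB).
Qed.

Lemma paving_del N G e : supported N G -> e \in G -> ~~ is_coloop N e ->
  paving4 N G -> paving4 (del N e) (G :\ e).
Proof.
move=> onG eG ce pav A; rewrite subsetD1 => /andP[AG eA].
rewrite rank_del ?inE ?eqxx // => le; rewrite /= /del_indep eA pav //.
by apply: leq_trans le _; apply: rankS; apply: subD1set.
Qed.

Lemma paving_con N G e : supported N G -> e \in G -> indep N [set e] ->
  paving4 N G -> paving4 (con N e) (G :\ e).
Proof.
move=> onG eG ie pav A; rewrite subsetD1 => /andP[AG eA] le.
rewrite con_indepE // eA pav ?subUset ?sub1set ?eG //.
by rewrite -{1}(setD1K eG) rank_con ?inE ?eqxx // cardsU1 eA.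
Qed.

(** Each [e] outside [B] has its partner [phi e] in [B]. If there are six such [e], exchanging the
    partners of all but [d0] for [d0] gives a set of size at most [#|B| - 4], independent by paving.
    A basis between it and [d0 |: B] misses every other [e], so it contains all their partners,
    hence [d0 |: B], which is too large. *)
Lemma series_card N G B : supported N G -> loop_coloop_free N G -> paving4 N G -> basis N B ->
    {in G, forall e, exists2 f, f != e & series N e f} ->
  (#|G :\: B| <= 5)%N.
Proof.
move=> onG lcf pav bB ser; rewrite leqNgt; apply/negP=> m6.
have BG : B \subset G by apply/onG/basis_indep.
pose phi e := odflt e [pick f | (f != e) && series N e f].
have phiP e : e \in G -> phi e != e /\ series N e (phi e).
  move=> /ser[f fe sef]; rewrite /phi; case: pickP => [g /andP[]//|/(_ f)].
  by rewrite fe sef.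
have phiB e : e \in G :\: B -> phi e \in B.
  rewrite inE => /andP[eB eG]; have [_ /forallP/(_ B)] := phiP e eG.
  by rewrite bB (negbTE eB).
(* A basis that avoids a common partner of [e] and [e'] but contains the rest of [B] must contain
   both [e] and [e'], one element too many. *)
have phiI : {in G :\: B &, injective phi}.
  move=> e e' eD eD' eq; move: (eD) (eD'); rewrite !inE => /andP[eB eG] /andP[eB' eG'].
  have /andP[ie _] := lcf e eG; have fB := phiB e eD.
  have /andP[_ cf] := lcf _ (subsetP BG _ fB).
  have [B0 bB0 fB0] := coloopPn _ _ cf.
  have indD : indep N (B :\ phi e) by apply: indepS (basis_indep bB); apply: subD1set.
  have [K [bK DK KU]] := basisI bB0 indD.
  have fK : phi e \notin K.
    by apply/negP=> /(subsetP KU); rewrite !inE eqxx (negbTE fB0).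
  have inK u : u \in G -> phi u = phi e -> u \in K.
    move=> uG pu; have [_ /forallP/(_ K)] := phiP u uG.
    by rewrite bK pu (negbTE fK) orbF.
  apply/eqP; apply: contraT => ne.
  have : [set e; e'] :|: (B :\ phi e) \subset K.
    by rewrite !subUset !sub1set DK !inK.
  move/subset_leq_card; rewrite (basis_eq_card bK bB) -setUA !cardsU1 !inE.
  rewrite (negbTE ne) (negbTE eB) (negbTE eB') !andbF /= (cardsD1 (phi e) B) fB.
  by rewrite !add1n ltnn.
have /card_gt0P[d0 d0D] : (0 < #|G :\: B|)%N by apply: leq_trans m6.
have := d0D; rewrite inE => /andP[d0B d0G].
pose P := phi @: ((G :\: B) :\ d0).
have PB : P \subset B.
  by apply/subsetP=> z /imsetP[e]; rewrite in_setD1 => /andP[_ eD] ->; apply: phiB.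
have cP : #|G :\: B| = #|P|.+1.
  rewrite card_in_imset; first by rewrite (cardsD1 d0) d0D.
  by apply: sub_in2 phiI => u; rewrite in_setD1 => /andP[].
have d0A : d0 \notin B :\: P by rewrite inE (negbTE d0B) andbF.
have cA : (#|d0 |: (B :\: P)| + #|P| = #|B|.+1)%N.
  by rewrite cardsU1 d0A cardsDS // -addnA subnK ?subset_leq_card.
have indA : indep N (d0 |: (B :\: P)).
  apply: pav; first by rewrite subUset sub1set d0G (subset_trans (subsetDl _ _)).
  by rewrite (rank_basis onG bB); clear -cA cP m6; lia.
have [K [bK AK KU]] := basisI bB indA.
have PK : P \subset K.
  apply/subsetP=> z /imsetP[e]; rewrite in_setD1 inE => /and3P[ed eB eG] ->.
  have [_ /forallP/(_ K)] := phiP e eG; rewrite bK /= => /orP[|//].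
  by move/(subsetP KU); rewrite !inE (negbTE ed) (negbTE eB) !andbF.
have : d0 |: B \subset K.
  by rewrite -(setID B P) (setIidPr PB) setUCA subUset PK.
by move/subset_leq_card; rewrite (basis_eq_card bK bB) cardsU1 d0B add1n ltnn.
Qed.

Lemma merino_welsh_paving N G : supported N G -> loop_coloop_free N G -> paving4 N G ->
  merino_welsh N G.
Proof.
have [n] := ubnP #|G|; elim: n N G => // n IHn N G; rewrite ltnS => leG onG lcf pav.
have [B bB _] := indep_basis (indep0 N).
have [/exists_inP[e eG /andP[/forall_inP np /forall_inP ns]]|] :=
    boolP [exists e in G, [forall f in G :\ e, ~~ parallel N e f] &&
                          [forall f in G :\ e, ~~ series N e f]].
  have /andP[ie ce] := lcf e eG.
  have leGe : (#|G :\ e| < n)%N by move: leG; rewrite (cardsD1 e) eG.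
  have onD := supported_del (e := e) onG; have onC := supported_con (e := e) onG.
  have mwD := IHn _ _ leGe onD (lcf_del lcf eG ns) (paving_del onG eG ce pav).
  have mwC := IHn _ _ leGe onC (lcf_con lcf eG np) (paving_con onG eG ie pav).
  have [d1 d2 d3] := tau_ge0 onD; have [c1 c2 c3] := tau_ge0 onC.
  rewrite /merino_welsh !(tau_delcon _ _ onG eG ie ce) -[X in X <= _]mul1r.
  by apply: cauchy_add => //; rewrite mul1r.
rewrite negb_exists_in => /forall_inP all2.
apply: (merino_welsh_small onG lcf bB).
have [/exists_inP[e eG /exists_inP[f fG /andP[ef par]]]|/exists_inPn nopar] :=
    boolP [exists e in G, [exists f in G, (e != f) && parallel N e f]].
  rewrite -(rank_basis onG bB) leqNgt; apply/orP; left; apply: contra par => r6.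
  by apply: pav; rewrite ?subUset ?sub1set ?eG ?fG // cards2 ef.
apply/orP; right; apply: (series_card onG lcf pav bB) => e eG.
move: (all2 e eG); rewrite negb_and !negb_forall_in => /orP[]/exists_inP[f].
  rewrite !inE negbK => /andP[fe fG] par; case/negP: (nopar e eG).
  by apply/exists_inP; exists f; rewrite // eq_sym fe.
by rewrite !inE negbK => /andP[fe fG] ser; exists f.
Qed.

(** Complementation maps bases to dual bases and keeps the exchange graphs; only the roles of the
    two sides, hence of [x] and [y], are interchanged. *)
Lemma tau_dual N x y : tau x y (dual N) setT = tau y x N setT.
Proof.
rewrite !tau_exch_sum //; try by move=> A _; apply: subsetT.
rewrite [RHS](reindex_inj (inv_inj (@setCK E))) /=.
apply: eq_big => [B|B _]; first exact: dual_basis.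
rewrite -(ptC _ x y) setCK; apply: eq_pt => // u v _ _.
rewrite /exch dual_basis !inE; congr (_ && basis N _).
  by case: (u \in B); case: (v \in B).
by apply/setP=> z; rewrite !inE; case: (z \in B); case: (_ || _).
Qed.

Lemma tutte_tau N (a b : int) : ((tutte N).[a, b])%:~R = tau a%:~R b%:~R N setT.
Proof.
rewrite horner2_tutte rmorph_sum; apply: eq_big => [A|A _]; first by rewrite subsetT.
by rewrite rmorphM !rmorphXn !rmorphB.
Qed.

Lemma loop_dep N e : loop N e = ~~ indep N [set e].
Proof.
apply/minsetP/idP=> [[]//|de]; split=> // B dB; rewrite subset1 => /orP[/eqP//|/eqP B0].
by rewrite B0 indep0 in dB.
Qed.

Lemma paving_paving4 N : paving N 4 -> paving4 N setT.
Proof.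
move=> pav A _ le; apply: contraTT le => dA.
have [C cC CA] := @minset_exists _ (fun A => ~~ indep N A) A dA.
rewrite -ltnNge; apply: leq_trans (pav C cC) _.
by rewrite leq_add2r subset_leq_card.
Qed.

Lemma merino_welsh_matroid N : (forall e, ~~ loop N e) -> (forall e, ~~ loop (dual N) e) ->
  paving N 4 -> merino_welsh N setT.
Proof.
move=> nl ncl pav; apply: merino_welsh_paving => [A _|e _|].
- exact: subsetT.
- have := nl e; have := ncl e; rewrite !loop_dep !negbK => ie ->.
  case/existsP: ie => B /andP[bB eB]; apply/coloopPn; exists B => //.
  by move: eB; rewrite sub1set inE.
exact: paving_paving4.
Qed.

Lemma loop_dual2 N e : loop (dual (dual N)) e = loop N e.
Proof.
rewrite !loop_dep; congr (~~ _); apply/existsP/idP=> [[B /andP[]]|ie].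
  rewrite dual_basis => bB eB; exact: indepS eB (basis_indep bB).
have [B bB eB] := indep_basis ie; exists (~: B).
by rewrite dual_basis setCK bB.
Qed.

End MerinoWelsh.

Theorem theorem4 (E : finType) (M : matroid E)
    (loopless : forall e : E, ~~ loop M e)
    (coloopless : forall e : E, ~~ coloop M e)
    (hpav : paving M 4 \/ copaving M 4) :
  (tutte M).[2, 0] * (tutte M).[0, 2] >= (tutte M).[1, 1] ^+ 2.
Proof.
rewrite -(ler_int rat) rmorphXn rmorphM /= !tutte_tau.
case: hpav => pav; first exact: merino_welsh_matroid.
have loopless' e : ~~ loop (dual (dual M)) e by rewrite loop_dual2.
have := merino_welsh_matroid coloopless loopless' pav.
by rewrite /merino_welsh !tau_dual mulrC.
Qed.
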